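(* Let $\Gamma=\{a,b,c,d\}$, $L^{\mathrm{wrap}}=\{c^nwd^n:n\ge0,\ w\in\{a,b\}^+\}$, and let $h^{\mathrm{wrap}}:\Gamma^*\to M_{36}\times E$ be the finite-monoid morphism defined in the context. For $s\in M_{36}\setminus\{1\}$ put $\mathsf M_s=\{u\in\{a,b\}^+:h_{36}(u)=s\}$ and $W_s=\{c^iud^i:i\ge1,\ u\in\mathsf M_s\}$; put $C=\{c\}$, $D=\{d\}$; and let $\mathsf P_{36}=\{s\in M_{36}\setminus\{1\}:\mathsf M_s\text{ is a relative prime}\}$. Then the set of relative primes of $(L^{\mathrm{wrap}},h^{\mathrm{wrap}})$ is exactly $$\mathcal P_{\mathrm{wrap}}=\{C,D\}\cup\{\mathsf M_p:p\in\mathsf P_{36}\}\cup\{W_s:s\in M_{36}\setminus\{1\}\},$$ and hence $|\mathcal P_{\mathrm{wrap}}|=2+15+35=52$. Moreover every live non-unit relative class of $(L^{\mathrm{wrap}},h^{\mathrm{wrap}})$ has a unique exact factorization into relative primes.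
   Context: The monoid $M_{36}$. Let $Q_0=\{0,1,2,3\}$. A transformation $f:Q_0\to Q_0$ is written as the tuple $(f(0),f(1),f(2),f(3))$, and products are composed from left to right: $(fg)(x)=g(f(x))$. Put $\tau_a=(1,2,0,0)$, $\tau_b=(1,3,1,0)$, and let $M_0$ be the submonoid (containing the identity) of the full transformation monoid on $Q_0$ generated by $\tau_a,\tau_b$. Let $h_0:\{a,b\}^*\to M_0$ be the morphism with $h_0(a)=\tau_a$, $h_0(b)=\tau_b$. Let $\sim_0$ be the least monoid congruence on $M_0$ with $h_0(ab)\sim_0 h_0(abaaab)$, let $M_{36}=M_0/{\sim_0}$ with projection $\pi_0$, and $h_{36}=\pi_0\circ h_0:\{a,b\}^*\to M_{36}$. The monoid $M_{36}$ has 36 elements. The observer $h^{\mathrm{wrap}}$. Extend $h_{36}$ to $\widehat h_{36}:\Gamma^*\to M_{36}$ by $\widehat h_{36}(c)=\widehat h_{36}(d)=1$. Let $E=\{0,1\}^2$ with coordinatewise maximum as multiplication, and let $\chi(w)\in E$ record in its first coordinate whether $c$ occurs in $w$ and in its second whether $d$ occurs in $w$. Put $h^{\mathrm{wrap}}(w)=(\widehat h_{36}(w),\chi(w))$. General definitions, for a language $L$ over a finite alphabet $\Sigma$ and a monoid morphism $h:\Sigma^*\to M$ into a finite monoid. $D_L(x)=\{(u,v):uxv\in L\}$; $x\equiv_L y$ iff $D_L(x)=D_L(y)$. The relative syntactic congruence $\theta$ is: $x\,\theta\,y$ iff $x\equiv_L y$ and $h(x)=h(y)$; its classes $[x]$ are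 called relative classes. A relative class is live if $D_L(x)\neq\varnothing$ for its members. The unit class is $[\varepsilon]$; non-unit means different from it. $X\cdot Y=\{xy:x\in X,y\in Y\}$. A relative prime is a live non-unit relative class $P$ such that whenever $P=X\cdot Y$ (equality of sets) for relative classes $X,Y$, one of $X,Y$ is $[\varepsilon]$. An exact factorization of $X$ into relative primes is a finite nonempty sequence $(P_1,\dots,P_k)$ of relative primes with $X=P_1\cdot\ldots\cdot P_k$ as sets of words. All of these notions in the claim refer to $(L^{\mathrm{wrap}},h^{\mathrm{wrap}})$, except that in the definition of $\mathsf P_{36}$ ''relative prime'' may equivalently be read for the pair $(\{a,b\}^+,h_{36})$ over the alphabet $\{a,b\}$. *)

(* Defs.v *)
From HB Require Import structures.
From mathcomp Require Import all_boot.
From mathcomp Require Import boolp classical_sets functions cardinality.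

Set Implicit Arguments.
Unset Strict Implicit.
Unset Printing Implicit Defensive.

Local Open Scope group_scope.

HB.instance Definition _ (T : choiceType) :=
  isMonoid.Build (seq T) (@catA T) (@cat0s T) (@cats0 T).

(* [trans] is kept apart from [{ffun _ -> _}], which carries the pointwise
   product.  The product here is composition from left to right. *)
Definition trans (T : finType) : Type := {ffun T -> T}.

Section Trans.
Variable T : finType.

HB.instance Definition _ := Finite.on (trans T).

Definition trans_mul (f g : trans T) : trans T := [ffun x => g (f x)].
Definition trans_one : trans T := [ffun x => x].

Fact trans_mulA : associative trans_mul.
Proof. by move=> f g k; apply/ffunP=> x; rewrite !ffunE. Qed.
Fact trans_mul1 : left_id trans_one trans_mul.
Proof. by move=> f; apply/ffunP=> x; rewrite !ffunE. Qed.
Fact trans_mulr1 : right_id trans_one trans_mul.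
Proof. by move=> f; apply/ffunP=> x; rewrite !ffunE. Qed.

HB.instance Definition _ :=
  isMonoid.Build (trans T) trans_mulA trans_mul1 trans_mulr1.
End Trans.

Definition Q0 := 'I_4.

(* The transformation written as the tuple (f(0), f(1), f(2), f(3)). *)
Definition trans_of (s : seq nat) : trans Q0 :=
  [ffun x : Q0 => inord (nth 0%N s x)].

Definition tau_a : trans Q0 := trans_of [:: 1; 2; 0; 0]%N.
Definition tau_b : trans Q0 := trans_of [:: 1; 3; 1; 0]%N.

Definition is_submonoid (S : {set trans Q0}) : bool :=
  (1 \in S) && [forall x in S, forall y in S, x * y \in S].

(* The least submonoid containing tau_a and tau_b. *)
Definition M0_set : {set trans Q0} :=
  (\bigcap_(S : {set trans Q0} |
      [&& is_submonoid S, tau_a \in S & tau_b \in S]) S)%SET.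

Definition M0_pred : pred (trans Q0) := fun f => f \in M0_set.

Fact M0_closed : monoid_closed M0_pred.
Proof.
split; first by apply/bigcapP=> S /andP[/andP[]].
move=> x y /bigcapP Hx /bigcapP Hy; apply/bigcapP=> S HS.
case/andP: (HS) => /andP[_ /forall_inP H] _.
by move/forall_inP: (H _ (Hx _ HS)); apply; apply: Hy.
Qed.

Definition M0 : Type := {f : trans Q0 | M0_pred f}.
HB.instance Definition _ := SubFinite.on M0.
HB.instance Definition _ :=
  SubChoice_isSubMonoid.Build (trans Q0) M0_pred M0 M0_closed.

Fact tau_a_in : M0_pred tau_a.
Proof. by apply/bigcapP=> S /and3P[]. Qed.
Fact tau_b_in : M0_pred tau_b.
Proof. by apply/bigcapP=> S /and3P[]. Qed.

Inductive AB := La | Lb.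
Definition bool_of_AB x := if x is La then true else false.
Definition AB_of_bool (x : bool) := if x then La else Lb.
Fact bool_of_ABK : cancel bool_of_AB AB_of_bool. Proof. by case. Qed.
HB.instance Definition _ := Finite.copy AB (can_type bool_of_ABK).

Definition h0 (w : seq AB) : M0 :=
  \prod_(x <- w)
    (match x with
     | La => exist _ tau_a tau_a_in
     | Lb => exist _ tau_b tau_b_in
     end : M0).

Definition is_congruence (R : {set M0 * M0}) : bool :=
  [&& [forall x, (x, x) \in R],
      [forall x, forall y, ((x, y) \in R) ==> ((y, x) \in R)],
      [forall x, forall y, forall z,
        ((x, y) \in R) && ((y, z) \in R) ==> ((x, z) \in R)] &
      [forall x, forall y, forall z, forall t,
        ((x, y) \in R) && ((z, t) \in R) ==> ((x * z, y * t) \in R)]].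

(* The least congruence relating h0(ab) and h0(abaaab). *)
Definition sim0_set : {set M0 * M0} :=
  (\bigcap_(R : {set M0 * M0} |
      is_congruence R &&
      ((h0 [:: La; Lb], h0 [:: La; Lb; La; La; La; Lb]) \in R)) R)%SET.

Definition sim0 : rel M0 := fun x y => (x, y) \in sim0_set.

Fact sim0_refl : reflexive sim0.
Proof. by move=> x; apply/bigcapP=> R /andP[/and4P[/forallP H]]. Qed.

Fact sim0_sym : symmetric sim0.
Proof.
suff H x y : sim0 x y -> sim0 y x by move=> x y; apply/idP/idP; apply: H.
move=> /bigcapP Hxy; apply/bigcapP=> R HR; move: (Hxy R HR).
by case/andP: HR => /and4P[_ /forallP/(_ x)/forallP/(_ y)/implyP].
Qed.

Fact sim0_trans : transitive sim0.
Proof.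
move=> y x z /bigcapP Hxy /bigcapP Hyz; apply/bigcapP=> R HR.
move: (Hxy R HR) (Hyz R HR) => h1 h2; case/andP: HR => /and4P[_ _].
by move=> /forallP/(_ x)/forallP/(_ y)/forallP/(_ z); rewrite h1 h2.
Qed.

Fact sim0_mul x y z t : sim0 x y -> sim0 z t -> sim0 (x * z) (y * t).
Proof.
move=> /bigcapP Hxy /bigcapP Hzt; apply/bigcapP=> R HR.
move: (Hxy R HR) (Hzt R HR) => h1 h2; case/andP: HR => /and4P[_ _ _].
move=> /forallP/(_ x)/forallP/(_ y)/forallP/(_ z)/forallP/(_ t).
by rewrite h1 h2.
Qed.

Canonical sim0_equiv := EquivRel sim0 sim0_refl sim0_sym sim0_trans.

Local Open Scope quotient_scope.

Definition M36 : Type := {eq_quot sim0}.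
HB.instance Definition _ := EqQuotient.on M36.
HB.instance Definition _ := Countable.on M36.

Fact M36_enumP :
  Finite.axiom (undup [seq \pi_M36 x | x <- Finite.enum M0] : seq M36).
Proof.
apply: Finite.uniq_enumP => [|x]; first exact: undup_uniq.
rewrite mem_undup -[x]reprK; apply: map_f.
by rewrite -enumT mem_enum.
Qed.
HB.instance Definition _ := isFinite.Build M36 M36_enumP.

Definition pi0 : M0 -> M36 := \pi_M36.
Definition M36_mul (x y : M36) : M36 := pi0 (repr x * repr y).
Definition M36_one : M36 := pi0 1.

Fact pi0_mul x y : M36_mul (pi0 x) (pi0 y) = pi0 (x * y).
Proof.
suff H z : sim0 (repr (pi0 z)) z by apply/eqmodP/sim0_mul; apply: H.
by apply/(@eqmodP _ sim0_equiv); apply: reprK.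
Qed.

Fact pi0_repr x : pi0 (repr x) = x.
Proof. exact: reprK. Qed.

Fact M36_mulA : associative M36_mul.
Proof.
move=> x y z; rewrite -[x]pi0_repr -[y]pi0_repr -[z]pi0_repr.
by rewrite !pi0_mul mulgA.
Qed.
Fact M36_mul1 : left_id M36_one M36_mul.
Proof. by move=> x; rewrite -[x]pi0_repr pi0_mul mul1g. Qed.
Fact M36_mulr1 : right_id M36_one M36_mul.
Proof. by move=> x; rewrite -[x]pi0_repr pi0_mul mulg1. Qed.

HB.instance Definition _ := isMonoid.Build M36 M36_mulA M36_mul1 M36_mulr1.

Fact pi0_is_morphism : monoid_morphism pi0.
Proof. by split=> // x y; rewrite -pi0_mul. Qed.

(* {0,1} under maximum. *)
Definition maxb : Type := bool.
HB.instance Definition _ := Finite.on maxb.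
HB.instance Definition _ := isMonoid.Build maxb orbA orFb orbF.

Definition E : Type := (maxb * maxb)%type.
HB.instance Definition _ := Finite.on E.
HB.instance Definition _ := Monoid.on E.

Inductive CD := Lc | Ld.
Definition bool_of_CD x := if x is Lc then true else false.
Definition CD_of_bool (x : bool) := if x then Lc else Ld.
Fact bool_of_CDK : cancel bool_of_CD CD_of_bool. Proof. by case. Qed.
HB.instance Definition _ := Finite.copy CD (can_type bool_of_CDK).

(* {a,b,c,d}, with {a,b}^* embedded by [map inl]. *)
Definition Gamma : Type := (AB + CD)%type.
HB.instance Definition _ := Finite.on Gamma.

Definition lc : Gamma := inr Lc.
Definition ld : Gamma := inr Ld.
Definition emb : seq AB -> seq Gamma := map inl.

Definition h36 (w : seq AB) : M36 := pi0 (h0 w).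

Definition hhat36 (w : seq Gamma) : M36 :=
  \prod_(x <- w) (if x is inl y then h36 [:: y] else 1).

Definition chi (w : seq Gamma) : E := (lc \in w, ld \in w).

Definition hwrap (w : seq Gamma) : M36 * E := (hhat36 w, chi w).

Fact h36_is_morphism : monoid_morphism h36.
Proof.
split=> [|u v]; rewrite /h36 /h0 ?big_nil ?big_cat ?pi0_is_morphism.1 //.
exact: pi0_is_morphism.2.
Qed.

Fact hhat36_emb w : hhat36 (emb w) = h36 w.
Proof.
elim: w => [|x w IH]; rewrite /hhat36 ?big_nil ?h36_is_morphism.1 //= big_cons.
by rewrite -/(hhat36 _) IH -h36_is_morphism.2.
Qed.

Fact hwrap_is_morphism : monoid_morphism hwrap.
Proof.
split=> [|u v]; rewrite /hwrap /hhat36 ?big_nil // big_cat /chi !mem_cat //.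
Qed.

Local Open Scope classical_set_scope.

Section Relative.
Variables (Sigma M : finType) (L : set (seq Sigma)) (h : seq Sigma -> M).

Definition contexts (x : seq Sigma) : set (seq Sigma * seq Sigma) :=
  [set c | L (c.1 ++ x ++ c.2)].

Definition theta (x y : seq Sigma) : Prop :=
  contexts x = contexts y /\ h x = h y.

Definition rel_class (x : seq Sigma) : set (seq Sigma) := [set y | theta x y].

Definition is_rel_class (X : set (seq Sigma)) : Prop :=
  exists x, X = rel_class x.

Definition live (X : set (seq Sigma)) : Prop :=
  exists2 x, X x & contexts x !=set0.

Definition unit_class : set (seq Sigma) := rel_class [::].

Definition lang_mul (X Y : set (seq Sigma)) : set (seq Sigma) :=
  [set z | exists x y, [/\ X x, Y y & z = x ++ y]].

Definition rel_prime (P : set (seq Sigma)) : Prop :=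
  [/\ is_rel_class P, live P, P <> unit_class &
      forall X Y, is_rel_class X -> is_rel_class Y -> P = lang_mul X Y ->
        X = unit_class \/ Y = unit_class].

Definition exact_factorization (X : set (seq Sigma))
    (s : seq (set (seq Sigma))) : Prop :=
  [/\ s <> [::], {in s, forall P, rel_prime P} &
      X = foldr lang_mul [set [::]] s].
End Relative.

Definition Lplus : set (seq AB) := [set w | w <> [::]].

Definition Lwrap : set (seq Gamma) :=
  [set z | exists (n : nat) (w : seq AB),
     Lplus w /\ z = nseq n lc ++ emb w ++ nseq n ld].

Definition Mlang (s : M36) : set (seq AB) := [set u | Lplus u /\ h36 u = s].

Definition Mwrap (s : M36) : set (seq Gamma) := emb @` Mlang s.

Definition Wwrap (s : M36) : set (seq Gamma) :=
  [set z | exists (i : nat) (u : seq AB),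
     [/\ (1 <= i)%N, Mlang s u & z = nseq i lc ++ emb u ++ nseq i ld]].

Definition Clang : set (seq Gamma) := [set [:: lc]].
Definition Dlang : set (seq Gamma) := [set [:: ld]].

(* Primality is taken for ({a,b}^+, h36), not for (Lwrap, hwrap). *)
Definition P36 : set M36 := [set s | s <> 1 /\ rel_prime Lplus h36 (Mlang s)].

Definition Pwrap : set (set (seq Gamma)) :=
  [set Clang; Dlang] `|` Mwrap @` P36 `|` Wwrap @` [set s | s <> 1].

(* Main.v *)
(* M36 is handled through the automaton of its right Cayley graph: h36 w is
   determined by the state reached on w.  Each state transition is an instance of
   the defining relation, and conversely "same state" is a congruence on M0
   containing that relation.

   Over {a,b} the live classes are the fibers of h36.  If the fiber of s is a
   product of fibers, then in particular the least word of s splits accordingly,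
   which leaves finitely many candidate factorizations.  Words of length at most
   11 refute all wrong candidates, and an automaton remembering the possible
   remainders of a word after a prefix in the fiber of p confirms the others.

   Live words over {a,b,c,d} have the form c^i u d^j.  Their class is determined
   by i - j, h36 u and whether i and j vanish, so a live class is
   C^i M_s D^j or C^i W_s D^j with i = 0 or j = 0.  W_s is prime because in a
   product of two non-unit classes the single c of c u d comes from the left
   factor and the single d from the right one.  Mixing this splitting with one of
   c c u d d then forces c c u d d to contain a single c. *)

Require Import Defs.
From mathcomp Require Import all_boot zify.
From mathcomp Require Import boolp classical_sets functions cardinality.

Set Implicit Arguments.
Unset Strict Implicit.
Unset Printing Implicit Defensive.

Local Open Scope classical_set_scope.
Local Open Scope card_scope.

(** * A computable model of M36 *)

(* The right Cayley graph of M36; code i is the i-th element in the shortlex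
   order of least representatives, and the pair lists i * a and i * b. *)
Definition delta_table : seq (nat * nat) :=
  [:: (1, 2); (3, 4); (5, 6); (7, 8); (9, 10); (11, 12); (11, 13); (1, 14);
      (15, 16); (17, 18); (17, 17); (19, 14); (20, 21); (19, 2); (22, 23);
      (24, 18); (24, 24); (25, 4); (18, 18); (5, 26); (27, 18); (27, 27);
      (28, 18); (28, 28); (29, 8); (9, 4); (30, 31); (32, 12); (33, 14);
      (15, 8); (34, 18); (34, 34); (20, 12); (22, 14); (35, 26); (30, 26)].

Definition delta (i : nat) (x : AB) : nat :=
  let p := nth (0, 0) delta_table i in if x is La then p.1 else p.2.

Definition run_from : nat -> seq AB -> nat := foldl delta.

Notation run := (run_from 0).

Fixpoint words_of_size (n : nat) : seq (seq AB) :=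
  if n is m.+1 then
    let ws := words_of_size m in map (cons La) ws ++ map (cons Lb) ws
  else [:: [::]].

Definition short_words (n : nat) : seq (seq AB) :=
  flatten (map words_of_size (iota 0 n.+1)).

(** Words are listed by length and then with a before b, so the first one reaching a state is its
    shortlex least representative. The longest representative has length 8. *)
Definition rep_table : seq (seq AB) := Eval vm_compute in
  let ws := [seq (run w, w) | w <- short_words 8] in
  [seq (head (0, [::]) [seq p <- ws | p.1 == i]).2 | i <- iota 0 36].

Definition rep (i : nat) : seq AB := nth [::] rep_table i.

Definition ev_step (t : seq nat) (x : AB) : seq nat :=
  map (nth 0 (if x is La then [:: 1; 2; 0; 0] else [:: 1; 3; 1; 0])) t.

Definition ev : seq AB -> seq nat := foldl ev_step [:: 0; 1; 2; 3].

(** An unverified search with fuel: nothing is proved about it. Each use rechecks by computation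
    that the initial state belongs to the result and that the result is closed under the steps. *)
Fixpoint reach (S : eqType) (step : S -> AB -> S) (n : nat) (st : seq S) :=
  if n is m.+1 then
    let st' := undup (st ++ map (step^~ La) st ++ map (step^~ Lb) st) in
    if size st' == size st then st else reach step m st'
  else st.

Definition closed_under (S : eqType) (step : S -> AB -> S) (st : seq S) : bool :=
  all (fun s => (step s La \in st) && (step s Lb \in st)) st.

Lemma closed_under_foldl (S : eqType) (step : S -> AB -> S) (st : seq S) s w :
  closed_under step st -> s \in st -> foldl step s w \in st.
Proof.
move=> /allP cl; elim: w s => [|x w IH] s //= sst; apply: IH.
by have /andP[] := cl _ sst; case: x.
Qed.

Definition model_step (p : seq nat * nat) (x : AB) : seq nat * nat :=
  (ev_step p.1 x, delta p.2 x).

Definition model_states : seq (seq nat * nat) :=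
  reach model_step 36 [:: ([:: 0; 1; 2; 3], 0)].

(** The transformation of a word and its state are run in parallel. That no reachable transformation
    is paired with two states means that the state factors through M0. *)
Lemma model_states_functional :
  [&& ([:: 0; 1; 2; 3], 0) \in model_states, closed_under model_step model_states &
    all (fun p => all (fun q => (p.1 == q.1) ==> (p.2 == q.2)) model_states)
      model_states].
Proof. vm_cast_no_check (erefl true). Qed.

Lemma foldl_model_step t i w :
  foldl model_step (t, i) w = (foldl ev_step t w, run_from i w).
Proof. by elim: w t i => //= x w IH t i; rewrite IH. Qed.

Lemma ev_run u v : ev u = ev v -> run u = run v.
Proof.
have /and3P[m0 cl fn] := model_states_functional; move=> Euv.
have st w : (ev w, run w) \in model_states.
  by rewrite -foldl_model_step; apply: closed_under_foldl.
have /allP fu := allP fn _ (st u).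
by have := fu _ (st v); rewrite /= Euv eqxx => /eqP.
Qed.

Lemma run_cat i u v : run_from i (u ++ v) = run_from (run_from i u) v.
Proof. exact: foldl_cat. Qed.

Lemma run_rcons i u x : run_from i (rcons u x) = delta (run_from i u) x.
Proof. by rewrite -cats1 run_cat. Qed.

Lemma delta_lt i x : delta i x < 36.
Proof.
have H : all (fun p => (p.1 < 36) && (p.2 < 36)) delta_table by [].
rewrite /delta; case: (ltnP i (size delta_table)) => Hi; last first.
  by rewrite nth_default //; case: x.
by have /andP[] := all_nthP (0, 0) H i Hi; case: x.
Qed.

Lemma run_lt w : run w < 36.
Proof. by case/lastP: w => // w x; rewrite run_rcons delta_lt. Qed.

Lemma delta_neq0 i x : i < 36 -> delta i x != 0.
Proof.
have H : all (fun p => (p.1 != 0) && (p.2 != 0)) delta_table by [].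
by move=> Hi; have /andP[] := all_nthP (0, 0) H i Hi; rewrite /delta; case: x.
Qed.

Lemma run_eq0 w : run w = 0 <-> w = [::].
Proof.
split=> [|-> //]; case/lastP: w => // w x; rewrite run_rcons => /eqP.
by rewrite (negPf (delta_neq0 _ (run_lt w))).
Qed.

Lemma repK i : i < 36 -> run (rep i) = i.
Proof.
have /allP H : all (fun i => run (rep i) == i) (iota 0 36).
  by vm_cast_no_check (erefl true).
by move=> Hi; apply/eqP/H; rewrite mem_iota.
Qed.

(** Reading [w] from a state acts like right multiplication by the element of [w]. It suffices to
    check this along every edge of the graph from every starting state, and it makes equality of
    [run] a two-sided congruence. *)
Lemma run_from_rep i w : i < 36 -> run_from i w = run_from i (rep (run w)).
Proof.
have /allP H : all (fun i => all (fun j => all (fun x =>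
    run_from i (rep (delta j x)) == delta (run_from i (rep j)) x)
    [:: La; Lb]) (iota 0 36)) (iota 0 36).
  by vm_cast_no_check (erefl true).
move=> Hi; elim/last_ind: w => [|w x IH]; first by [].
have Hi' : i \in iota 0 36 by rewrite mem_iota.
have Hw : run w \in iota 0 36 by rewrite mem_iota run_lt.
have /and3P[/eqP Ha /eqP Hb _] := allP (H _ Hi') _ Hw.
rewrite !run_rcons IH.
by case: x.
Qed.

Lemma run_congr u u' v v' :
  run u = run u' -> run v = run v' -> run (u ++ v) = run (u' ++ v').
Proof.
move=> Eu Ev; rewrite !run_cat Eu (run_from_rep v (run_lt _)).
by rewrite (run_from_rep v' (run_lt _)) Ev.
Qed.

(** * Agreement of the model with M36 *)

Lemma ev_rcons w x : ev (rcons w x) = ev_step (ev w) x.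
Proof. exact: foldl_rcons. Qed.

Lemma size_ev w : size (ev w) = 4.
Proof. by elim/last_ind: w => // w x IH; rewrite ev_rcons size_map. Qed.

Lemma h0_cat u v : h0 (u ++ v) = (h0 u * h0 v)%g.
Proof. exact: big_cat. Qed.

Lemma val_h0 w (i : Q0) : (val (h0 w) : trans Q0) i = nth 0 (ev w) i :> nat.
Proof.
elim/last_ind: w => [|w x IH].
  rewrite /h0 big_nil /= ffunE.
  by case: i => [] [|[|[|[|]]]].
rewrite ev_rcons -cats1 h0_cat /= ffunE (nth_map 0) ?size_ev // -IH.
have -> : val (h0 [:: x]) = trans_of (if x is La then [:: 1; 2; 0; 0] else [:: 1; 3; 1; 0]).
  by rewrite /h0 big_seq1; case: x.
rewrite ffunE inordK //; move: (_ i) => k.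
by case: x; case: k => [] [|[|[|[|]]]].
Qed.

Lemma h0_ev u v : h0 u = h0 v <-> ev u = ev v.
Proof.
split=> [E|E].
  apply: (@eq_from_nth _ 0); rewrite !size_ev // => i Hi.
  by rewrite -[i]/(nat_of_ord (Ordinal Hi)) -!val_h0 E.
by apply: val_inj; apply/ffunP=> i; apply: val_inj; rewrite /= !val_h0 E.
Qed.

Lemma h0_surj (x : M0) : exists w, h0 w = x.
Proof.
pose S : {set trans Q0} := [set f | `[< exists w, val (h0 w) = f >]]%SET.
have S1 w : val (h0 w) \in S by rewrite inE; apply/asboolP; exists w.
suff : val x \in S by rewrite inE => /asboolP[w /val_inj]; exists w.
have /bigcapP := valP x; apply; apply/and3P; split.
- apply/andP; split; first by have := S1 [::]; rewrite /h0 big_nil.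
  apply/forall_inP=> f; rewrite inE => /asboolP[u <-].
  apply/forall_inP=> g; rewrite inE => /asboolP[v <-].
  by have := S1 (u ++ v); rewrite h0_cat.
- by have := S1 [:: La]; rewrite /h0 big_seq1.
- by have := S1 [:: Lb]; rewrite /h0 big_seq1.
Qed.

Lemma h36_cat u v : h36 (u ++ v) = (h36 u * h36 v)%g.
Proof. exact: h36_is_morphism.2. Qed.

Lemma h36_sim u v : h36 u = h36 v <-> sim0 (h0 u) (h0 v).
Proof. by split=> /(@eqmodP _ sim0_equiv). Qed.

Lemma h36_run u v : h36 u = h36 v -> run u = run v.
Proof.
move=> /h36_sim/bigcapP.
(* Having the same state is a congruence on M0 that contains the defining pair, hence it contains
   the least one. Representatives may be changed freely because [run] depends only on [h0]. *)
pose R : {set M0 * M0} :=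
  [set p | `[< exists u v, [/\ h0 u = p.1, h0 v = p.2 & run u = run v] >]]%SET.
have RP x y : reflect (exists u v, [/\ h0 u = x, h0 v = y & run u = run v])
    ((x, y) \in R) by rewrite inE; apply: asboolP.
have run_h0 w w' : h0 w = h0 w' -> run w = run w' by move/h0_ev/ev_run.
move=> /(_ R) H; suff /H/RP[u' [v' [/run_h0 <- /run_h0 <-]]] : 
  is_congruence R && ((h0 [:: La; Lb], h0 [:: La; Lb; La; La; La; Lb]) \in R) by [].
apply/andP; split; last by apply/RP; do 2!eexists; split.
apply/and4P; split.
- by apply/forallP=> x; have [w <-] := h0_surj x; apply/RP; exists w, w.
- apply/forallP=> x; apply/forallP=> y; apply/implyP=> /RP[a [b [<- <- E]]].
  by apply/RP; exists b, a.
- apply/forallP=> x; apply/forallP=> y; apply/forallP=> z; apply/implyP.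
  move=> /andP[/RP[a [b [<- <- E]]] /RP[b' [c [/run_h0 Eb <- E']]]].
  by apply/RP; exists a, c; rewrite E -E' Eb.
- apply/forallP=> x; apply/forallP=> y; apply/forallP=> z; apply/forallP=> t.
  apply/implyP=> /andP[/RP[a [b [<- <- E]]] /RP[c [d [<- <- E']]]].
  by apply/RP; exists (a ++ c), (b ++ d); rewrite !h0_cat; split=> //; apply: run_congr.
Qed.

(** At most one application of the defining relation, in either direction, tested on
    transformations. Contexts of length at most 3 already suffice for every edge of the Cayley
    graph. *)
Definition elementary (u v : seq nat) : bool :=
  let ws := short_words 3 in
  (u == v) || has (fun x => has (fun y =>
    let a := ev (x ++ [:: La; Lb] ++ y) in
    let b := ev (x ++ [:: La; Lb; La; La; La; Lb] ++ y) in
    ((u == a) && (v == b)) || ((u == b) && (v == a))) ws) ws.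

Lemma elementary_h36 u v : elementary (ev u) (ev v) -> h36 u = h36 v.
Proof.
have Eh : h36 [:: La; Lb] = h36 [:: La; Lb; La; La; La; Lb].
  by apply/h36_sim/bigcapP=> R /andP[].
have ev_h36 u' v' : ev u' = ev v' -> h36 u' = h36 v'.
  by move/h0_ev; rewrite /h36 => ->.
case/orP=> [/eqP/ev_h36 //|/hasP[x _ /hasP[y _]]].
have Exy : h36 (x ++ [:: La; Lb] ++ y) =
           h36 (x ++ [:: La; Lb; La; La; La; Lb] ++ y) by rewrite !h36_cat Eh.
by case/orP=> /andP[/eqP/ev_h36 -> /eqP/ev_h36 ->].
Qed.

(** By induction along [w], it is enough that each edge of the graph is justified by the relation:
    appending a letter to a representative gives the representative of the target state up to one
    elementary step. *)
Lemma h36_rep w : h36 w = h36 (rep (run w)).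
Proof.
have /allP H : all (fun i => all (fun x =>
    elementary (ev (rcons (rep i) x)) (ev (rep (delta i x)))) [:: La; Lb])
    (iota 0 36).
  by vm_cast_no_check (erefl true).
elim/last_ind: w => [//|w x IH].
rewrite run_rcons -cats1 h36_cat IH -h36_cat cats1; apply: elementary_h36.
have := H (run w); rewrite mem_iota run_lt => /(_ isT)/and3P[Ha Hb _].
by case: x.
Qed.

Lemma h36P u v : h36 u = h36 v <-> run u = run v.
Proof. by split=> [/h36_run //|E]; rewrite h36_rep (h36_rep v) E. Qed.

Definition elt (i : nat) : M36 := h36 (rep i).

Lemma h36_elt w : h36 w = elt (run w). Proof. exact: h36_rep. Qed.

Lemma elt_inj : {in [pred i | i < 36] &, injective elt}.
Proof. by move=> i j Hi Hj /h36P; rewrite !repK. Qed.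

Lemma elt0 : elt 0 = 1%g.
Proof. by rewrite /elt /h36 /h0 big_nil. Qed.

Lemma h36_surj (s : M36) : exists w, h36 w = s.
Proof.
have [w Ew] := h0_surj (repr s); exists w.
by rewrite /h36 Ew; apply: pi0_repr.
Qed.

Lemma elt_surj (s : M36) : exists2 i, i < 36 & elt i = s.
Proof.
by have [w <-] := h36_surj s; exists (run w); [exact: run_lt|rewrite h36_elt].
Qed.

(** No edge of the graph enters state 0, so a nonempty word never maps to the identity. *)
Lemma h36_eq1 w : h36 w = 1%g <-> w = [::].
Proof.
rewrite -elt0 h36_elt; split=> [E|-> //]; apply/run_eq0.
by apply: elt_inj E; rewrite ?inE ?run_lt.
Qed.

(** * Factorizations over {a,b} *)

Definition lang_prod (Sigma : finType) : seq (set (seq Sigma)) -> set (seq Sigma) :=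
  foldr (@lang_mul Sigma) [set [::]].

Lemma lang_mul1 (Sigma : finType) (X : set (seq Sigma)) : lang_mul X [set [::]] = X.
Proof.
apply/seteqP; split=> [z [x [y [Xx -> ->]]]|z Xz]; first by rewrite cats0.
by exists z, [::]; rewrite cats0.
Qed.

Lemma mul1lang (Sigma : finType) (X : set (seq Sigma)) : lang_mul [set [::]] X = X.
Proof. by apply/seteqP; split=> [z [x [y [-> Xy ->]]]|z Xz] //; exists [::], z. Qed.

Lemma lang_mulA (Sigma : finType) (X Y Z : set (seq Sigma)) :
  lang_mul X (lang_mul Y Z) = lang_mul (lang_mul X Y) Z.
Proof.
apply/seteqP; split=> z.
  case=> x [_ [Xx [y [t [Yy Zt ->]]] ->]].
  by exists (x ++ y), t; rewrite catA; split=> //; exists x, y.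
case=> _ [t [[x [y [Xx Yy ->]]] Zt ->]].
by exists x, (y ++ t); rewrite catA; split=> //; exists y, t.
Qed.

Lemma lang_prod_cat (Sigma : finType) (l l' : seq (set (seq Sigma))) :
  lang_prod (l ++ l') = lang_mul (lang_prod l) (lang_prod l').
Proof.
elim: l => [|X l IH] /=; first by rewrite mul1lang.
by rewrite -lang_mulA -IH.
Qed.

Lemma h36_nil : h36 [::] = 1%g.
Proof. exact: h36_is_morphism.1. Qed.

Definition fiber (s : M36) : set (seq AB) := [set w | h36 w = s].

Lemma fiber_neq0 s : fiber s !=set0.
Proof. exact: h36_surj. Qed.

Lemma fiber_inj : injective fiber.
Proof.
move=> s t E; have [w Hw] := fiber_neq0 s.
have : fiber t w by rewrite -E.
by rewrite /fiber /= -[s]Hw => ->.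
Qed.

Lemma fiber_elt i w : i < 36 -> fiber (elt i) w <-> run w = i.
Proof. by move=> Hi; rewrite /fiber /= h36P repK. Qed.

Lemma fiber1 : fiber 1%g = [set [::]].
Proof. by apply/seteqP; split=> w /h36_eq1. Qed.

Lemma Mlang_fiber s : s <> 1%g -> Mlang s = fiber s.
Proof.
move=> s1; apply/seteqP; split=> w; first by case.
by move=> Hw; split=> //; move=> w0; apply: s1; rewrite -Hw w0; apply/h36_eq1.
Qed.

(** The contexts of a word in [Lplus] depend only on whether the word is empty, and [h36] already
    detects this. *)
Lemma rel_class_Lplus x : rel_class Lplus h36 x = fiber (h36 x).
Proof.
apply/seteqP; split=> y; first by case.
move=> E; have E0 : x = [::] <-> y = [::] by rewrite -!h36_eq1 E.
split=> //; apply/seteqP; split=> -[u v] /= H; rewrite /contexts /Lplus /=.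
  by move=> /nilP; rewrite /nilp !size_cat !addn_eq0 !size_eq0;
    case/and3P=> /eqP u0 /eqP/E0 x0 /eqP v0; apply: H; rewrite u0 x0 v0.
by move=> /nilP; rewrite /nilp !size_cat !addn_eq0 !size_eq0;
  case/and3P=> /eqP u0 /eqP/E0 x0 /eqP v0; apply: H; rewrite u0 x0 v0.
Qed.

Lemma is_rel_class_Lplus X : is_rel_class Lplus h36 X <-> exists s, X = fiber s.
Proof.
split=> [[x ->]|[s ->]]; first by rewrite rel_class_Lplus; exists (h36 x).
by have [w <-] := h36_surj s; exists w; rewrite rel_class_Lplus.
Qed.

Lemma rel_prime_LplusP s : s <> 1%g ->
  rel_prime Lplus h36 (Mlang s) <->
  forall t u, fiber s = lang_mul (fiber t) (fiber u) -> t = 1%g \/ u = 1%g.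
Proof.
move=> s1; rewrite Mlang_fiber //.
have unitE : unit_class Lplus h36 = fiber 1%g.
  by rewrite /unit_class rel_class_Lplus (h36_eq1 _).2.
split=> [[_ _ _ H] t u E|H].
  by have [| | |] := H (fiber t) (fiber u) _ _ E;
    rewrite ?unitE; try (move/fiber_inj; auto); apply/is_rel_class_Lplus; eexists.
split; first by apply/is_rel_class_Lplus; exists s.
- have [w Hw] := fiber_neq0 s; exists w => //; exists ([:: La], [:: La]).
  by rewrite /contexts /Lplus /=.
- by rewrite unitE => /fiber_inj.
- move=> X Y /is_rel_class_Lplus[t ->] /is_rel_class_Lplus[u ->] /H.
  by rewrite unitE; case=> ->; [left|right].
Qed.

(** A canonical list for each set of codes: equal sets of remainders become equal automaton
    states. *)
Definition sort_codes (S : seq nat) : seq nat := [seq y <- iota 0 36 | y \in S].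

Arguments sort_codes : simpl never.

(* The second component of the state reached on w collects the codes of the
   words v such that w = u v with u of code p. *)
Definition remainder_step (p : nat) (s : nat * seq nat) (x : AB) : nat * seq nat :=
  let S := [seq delta y x | y <- s.2] in
  (* A remainder is recorded only from its first letter on, so the code 0 of the empty remainder
     never occurs. *)
  let S' := if s.1 == p then delta 0 x :: S else S in
  (delta s.1 x, sort_codes S').

(** The third test says that every word of code [s] has a splitting with codes [p] and [q], which
    gives one inclusion. The last test says that the product of [p] and [q] is [s], which gives the
    other. *)
Definition exact_pair (p q s : nat) : bool :=
  let st := reach (remainder_step p) 36 [:: (0, [::])] in
  [&& (0, [::]) \in st, closed_under (remainder_step p) st,
      all (fun t => (t.1 == s) ==> (q \in t.2)) st &
      run_from p (rep q) == s].

Lemma foldl_remainder_step p w :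
  let t := foldl (remainder_step p) (0, [::]) w in
  t.1 = run w /\ forall q, q \in t.2 -> exists u v, [/\ w = u ++ v, run u = p & run v = q].
Proof.
elim/last_ind: w => [|w x [E IH]] //=; rewrite foldl_rcons run_rcons /= E.
split=> // q; rewrite /sort_codes mem_filter => /andP[+ _].
have old : q \in [seq delta y x | y <- (foldl (remainder_step p) (0, [::]) w).2] ->
    exists u v, [/\ rcons w x = u ++ v, run u = p & run v = q].
  case/mapP=> y /IH[u [v [-> Eu Ev]]] ->; exists u, (rcons v x).
  by rewrite rcons_cat run_rcons Ev.
case: eqP => // Ep; rewrite in_cons => /orP[/eqP ->|//].
by exists w, [:: x]; rewrite cats1.
Qed.

Lemma exact_pair_fiber p q s : p < 36 -> q < 36 ->
  exact_pair p q s -> fiber (elt s) = lang_mul (fiber (elt p)) (fiber (elt q)).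
Proof.
move=> Hp Hq; rewrite /exact_pair; move: (reach _ _ _) => st.
case/and4P=> st0 cl /allP H /eqP Es.
have Hs : s < 36 by rewrite -Es -(repK Hp) -run_cat run_lt.
apply/seteqP; split=> w.
  move=> /(fiber_elt _ Hs) Ew; have [E1 E2] := foldl_remainder_step p w.
  have /implyP := H _ (closed_under_foldl w cl st0).
  rewrite E1 Ew eqxx => /(_ isT)/E2[u [v [-> Eu Ev]]].
  by exists u, v; split=> //; apply/fiber_elt.
case=> u [v [/(fiber_elt _ Hp) Eu /(fiber_elt _ Hq) Ev ->]]; apply/fiber_elt => //.
by rewrite run_cat Eu (run_from_rep v Hp) Ev.
Qed.

(* (s, (p, q)) for an exact factorization of the fiber of s into the prime
   fiber of p and the fiber of q. *)
Definition composite_table : seq (nat * (nat * nat)) :=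
  [:: (3, (1, 1)); (6, (2, 2)); (7, (1, 3)); (8, (1, 4)); (10, (4, 2));
      (13, (2, 6)); (15, (1, 9)); (16, (1, 10)); (21, (12, 2)); (23, (14, 2));
      (24, (1, 17)); (25, (17, 1)); (26, (2, 14)); (29, (1, 25)); (30, (2, 22));
      (31, (2, 23)); (32, (27, 1)); (33, (28, 1)); (34, (2, 28)); (35, (2, 33))].

Definition prime_codes : seq nat :=
  [:: 1; 2; 4; 5; 9; 11; 12; 14; 17; 18; 19; 20; 22; 27; 28].

Lemma composite_table_exact :
  all (fun t => exact_pair t.2.1 t.2.2 t.1) composite_table.
Proof. vm_cast_no_check (erefl true). Qed.

(** The bound [q < s] is what allows repeated splitting to terminate. *)
Lemma composite_code s : 0 < s < 36 -> s \notin prime_codes ->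
  exists p q, [/\ p \in prime_codes, 0 < q < s &
    fiber (elt s) = lang_mul (fiber (elt p)) (fiber (elt q))].
Proof.
move=> Hs sP.
have /allP : all (fun s => (s \in prime_codes) || (s \in map fst composite_table))
  (iota 1 35) by [].
move=> /(_ s); rewrite mem_iota (negPf sP) => /(_ Hs)/mapP[[s' [p q]] st /= Es].
have : all (fun t => (t.2.1 \in prime_codes) && (0 < t.2.2 < t.1)) composite_table by [].
move=> /allP/(_ _ st)/andP[/= pP Hq]; subst s'; exists p, q; split=> //.
apply: exact_pair_fiber; last exact: (allP composite_table_exact _ st).
  have : all (ltn^~ 36) prime_codes by [].
  by move/allP; apply.
by case/andP: Hs Hq => _ Hs /andP[_ /ltn_trans->].
Qed.

(** * Refutation of wrong factorizations by short words *)

Fixpoint compositions (w : seq AB) : seq (seq (seq AB)) :=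
  if w is x :: w' then
    let cs := compositions w' in
    map (cons [:: x]) cs ++
    pmap (fun c => if c is s :: c' then Some ((x :: s) :: c') else None) cs
  else [:: [::]].

Lemma mem_compositions c : all (fun s => ~~ nilp s) c -> c \in compositions (flatten c).
Proof.
move: {2}(flatten c) (erefl (flatten c)) => w.
elim: w c => [|x w IH] [|[//|y s] c] //= [-> E] Hc; rewrite E mem_cat; apply/orP.
case: s E => [|z s] E; first by left; apply: map_f; rewrite -E IH.
right; rewrite mem_pmap; apply/mapP; exists ((z :: s) :: c) => //.
by rewrite -E; apply: (IH ((z :: s) :: c)).
Qed.

(** The conditional replaces [&&] so that call-by-value evaluation explores the rest of the word
    only after a matching prefix. *)
Fixpoint splits (l : seq nat) (w : seq AB) : bool :=
  if l is p :: l' then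
    has (fun k => if run (take k w) == p then splits l' (drop k w) else false)
      (iota 0 (size w).+1)
  else nilp w.

(** Positive codes belong to nonempty words, so any splitting of [w] along [l] is one of the
    finitely many compositions of [w]. *)
Lemma lang_prod_compositions (l : seq nat) w :
  all (fun i => 0 < i < 36) l -> lang_prod [seq fiber (elt i) | i <- l] w ->
  l \in [seq [seq run u | u <- c] | c <- compositions w].
Proof.
move=> Hl Hw; suff [c [<- <- Hc]] : exists c,
  [/\ flatten c = w, [seq run u | u <- c] = l & all (fun s => ~~ nilp s) c].
  exact/map_f/mem_compositions.
elim: l Hl w Hw => [_ w ->|i l IH /= /andP[/andP[i0 Hi] /IH{}IH] w]; first by exists [::].
case=> u [v [/(fiber_elt _ Hi) Eu /IH[c [<- <- Hc]] ->]].
exists (u :: c); rewrite /= Eu Hc andbT; split=> //.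
by case: u Eu => //= E; rewrite -E in i0.
Qed.

Lemma lang_prod_splits (l : seq nat) w :
  all (ltn^~ 36) l -> lang_prod [seq fiber (elt i) | i <- l] w -> splits l w.
Proof.
elim: l w => [w _ -> //|i l IH w /andP[Hi Hl]].
case=> u [v [/(fiber_elt _ Hi) Eu /(IH _ Hl) Ev ->]].
have /hasP : exists2 k, k \in iota 0 (size (u ++ v)).+1 &
  if run (take k (u ++ v)) == i then splits l (drop k (u ++ v)) else false; last by [].
exists (size u); first by rewrite mem_iota size_cat ltnS leq_addr.
by rewrite take_size_cat // Eu eqxx drop_size_cat.
Qed.

(** The bound 11 is large enough for the two computations below to succeed. *)
Definition tests (s : nat) : seq (seq AB) := [seq w <- short_words 11 | run w == s].

Definition candidates (s : nat) : seq (seq nat) :=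
  [seq [seq run u | u <- c] | c <- compositions (rep s)].

Lemma lang_prod_candidate s l : 0 < s < 36 -> all (fun i => 0 < i < 36) l ->
  lang_prod [seq fiber (elt i) | i <- l] = fiber (elt s) ->
  l \in candidates s /\ all (splits l) (tests s).
Proof.
move=> /andP[s0 Hs] Hl E; split.
  by apply: lang_prod_compositions => //; rewrite E; apply/fiber_elt; rewrite ?repK.
apply/allP=> w; rewrite mem_filter => /andP[/eqP Ew _]; apply: lang_prod_splits.
  by apply: sub_all Hl => i /andP[].
by rewrite E; apply/fiber_elt.
Qed.

Lemma prime_code_candidates :
  all (fun s => let ts := tests s in
    all (fun l => if size l == 2 then ~~ all (splits l) ts else true) (candidates s))
    prime_codes.
Proof. vm_cast_no_check (erefl true). Qed.

(** Asking for a constant list, rather than for at most one entry, allows several compositions of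
    the representative to have the same codes. *)
Lemma prime_factorization_candidates :
  all (fun s => let ts := tests s in
    constant [seq l <- candidates s |
      if all (fun p => p \in prime_codes) l then all (splits l) ts else false])
    (iota 1 35).
Proof. vm_cast_no_check (erefl true). Qed.

Lemma prime_code_bounds i : i \in prime_codes -> 0 < i < 36.
Proof. by move: i; apply/allP. Qed.

Lemma elt_neq1 i : 0 < i < 36 -> elt i <> 1%g.
Proof.
move=> /andP[i0 Hi]; rewrite -elt0 => /elt_inj E.
by move: i0; rewrite E.
Qed.

Lemma elt_surj_neq1 s : s <> 1%g -> exists2 i, 0 < i < 36 & elt i = s.
Proof.
have [i Hi <-] := elt_surj s; case: i Hi => [|i Hi _]; first by rewrite elt0.
by exists i.+1.
Qed.

Lemma P36P s : P36 s <-> exists2 i, i \in prime_codes & elt i = s.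
Proof.
split=> [[s1 /(rel_prime_LplusP s1) H]|[i iP <-]].
  have [i Hi Ei] := elt_surj_neq1 s1; exists i => //; rewrite -Ei in H.
  apply: contrapT => /negP/(composite_code Hi)[p [q [pP /andP[q0 Hq] /H]]].
  case/andP: Hi => _ Hi.
  by case; apply: elt_neq1; [apply: prime_code_bounds|rewrite q0 (ltn_trans Hq)].
have Hi := prime_code_bounds iP; have i1 := elt_neq1 Hi.
split=> //; apply/rel_prime_LplusP => // t u E.
have [->|t1] := pselect (t = 1%g); first by left.
have [->|u1] := pselect (u = 1%g); first by right.
have [j Hj Ej] := elt_surj_neq1 t1; have [k Hk Ek] := elt_surj_neq1 u1.
have [||c sp] := @lang_prod_candidate i [:: j; k] Hi.
- by rewrite /= Hj Hk.
- by rewrite /= lang_mul1 Ej Ek.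
by have := allP (allP prime_code_candidates _ iP) _ c; rewrite /= sp.
Qed.

Lemma all_P36_codes (l : seq M36) : {in l, forall p, P36 p} ->
  exists2 k, all (fun i => i \in prime_codes) k & l = map elt k.
Proof.
elim: l => [|p l IH] H; first by exists [::].
have [|k Hk ->] := IH; first by move=> q ql; apply: H; rewrite in_cons ql orbT.
have /P36P[i iP <-] := H p (mem_head _ _).
by exists (i :: k); rewrite /= ?iP.
Qed.

Lemma fiber_factorization_unique s (l l' : seq M36) :
  {in l, forall p, P36 p} -> {in l', forall p, P36 p} ->
  lang_prod (map fiber l) = fiber s -> lang_prod (map fiber l') = fiber s -> l = l'.
Proof.
move=> /all_P36_codes[k Hk ->] /all_P36_codes[k' Hk' ->].
have [i Hi <-] := elt_surj s; rewrite -!map_comp.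
have codes j : all (fun i => i \in prime_codes) j -> all (fun i => 0 < i < 36) j.
  by apply: sub_all => x /prime_code_bounds.
(* Code 0 is outside the range of the computed test. Its fiber is the empty word, whose only
   composition is empty. *)
have [i0|] := posnP i.
  have nil0 j : all (fun i => i \in prime_codes) j ->
      lang_prod [seq fiber (elt i) | i <- j] = fiber (elt i) -> j = [::].
    move=> /codes Hj; rewrite i0 elt0 fiber1 => E.
    have : lang_prod [seq fiber (elt i) | i <- j] [::] by rewrite E.
    by move/(lang_prod_compositions Hj); rewrite mem_seq1 => /eqP.
  by move=> /(nil0 _ Hk) -> /(nil0 _ Hk') ->.
move=> i0; have Hi0 : 0 < i < 36 by rewrite i0.
move=> /(lang_prod_candidate Hi0 (codes _ Hk))[c sp].
move=> /(lang_prod_candidate Hi0 (codes _ Hk'))[c' sp'].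
have ii : i \in iota 1 35 by rewrite mem_iota.
move: (allP prime_factorization_candidates _ ii) => /=.
set good := [seq _ <- _ | _]; have kg : k \in good by rewrite mem_filter Hk sp.
have kg' : k' \in good by rewrite mem_filter Hk' sp'.
case: good kg kg' => // x r /[swap] k'r /[swap] /allP H.
have eqx y : y \in x :: r -> y = x.
  by rewrite in_cons => /predU1P[//|/H/eqP].
by move=> /eqx ->; rewrite (eqx _ k'r).
Qed.

(** Induction on the code: a composite fiber is a prime fiber times a fiber of smaller code. *)
Lemma fiber_factorization_exists s : exists l : seq M36,
  {in l, forall p, P36 p} /\ lang_prod (map fiber l) = fiber s.
Proof.
have [i Hi <-] := elt_surj s; elim/ltn_ind: i Hi => i IH Hi.
have [i0|i0] := posnP i; first by exists [::]; rewrite i0 elt0 fiber1.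
have [iP|iP] := boolP (i \in prime_codes).
  exists [:: elt i]; split; last by rewrite /= lang_mul1.
  by move=> p; rewrite mem_seq1 => /eqP ->; apply/P36P; exists i.
have Hi0 : 0 < i < 36 by rewrite i0.
have [p [q [pP /andP[q0 qi] E]]] := composite_code Hi0 iP.
have [l [Hl El]] := IH q qi (ltn_trans qi Hi).
exists (elt p :: l); split; last by rewrite /= -/(lang_prod _) El.
move=> x; rewrite in_cons => /predU1P[->|/Hl //].
by apply/P36P; exists p.
Qed.

(** * Relative classes of the wrapped language *)

Definition rank (x : Gamma) : nat :=
  match x with inl _ => 1 | inr Lc => 0 | inr Ld => 2 end.

Definition ordered (z : seq Gamma) : bool := sorted leq (map rank z).

Definition cc (z : seq Gamma) : nat := count_mem lc z.
Definition cd (z : seq Gamma) : nat := count_mem ld z.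
Definition ab (z : seq Gamma) : seq AB :=
  pmap (fun x => if x is inl y then Some y else None) z.

Definition block (i : nat) (u : seq AB) (j : nat) : seq Gamma :=
  nseq i lc ++ emb u ++ nseq j ld.

Lemma cc_cat z t : cc (z ++ t) = cc z + cc t. Proof. exact: count_cat. Qed.
Lemma cd_cat z t : cd (z ++ t) = cd z + cd t. Proof. exact: count_cat. Qed.
Lemma ab_cat z t : ab (z ++ t) = ab z ++ ab t. Proof. exact: pmap_cat. Qed.

Lemma cc_block i u j : cc (block i u j) = i.
Proof.
rewrite /cc !count_cat !count_nseq /= mul1n mul0n addn0 -[RHS]addn0; congr addn.
by elim: u.
Qed.

Lemma cd_block i u j : cd (block i u j) = j.
Proof.
rewrite /cd !count_cat !count_nseq /= mul1n mul0n -[RHS]add0n; congr addn.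
by elim: u.
Qed.

Lemma ab_block i u j : ab (block i u j) = u.
Proof.
rewrite /block !ab_cat; have -> : ab (nseq i lc) = [::] by elim: i.
have -> : ab (nseq j ld) = [::] by elim: j.
by rewrite cats0; elim: u => //= x u ->.
Qed.

Lemma ordered_cat z t :
  ordered (z ++ t) = [&& allrel leq (map rank z) (map rank t), ordered z & ordered t].
Proof. by rewrite /ordered map_cat !(sorted_pairwise leq_trans) pairwise_cat. Qed.

Lemma rank_cc z : (0 \in map rank z) = (0 < cc z).
Proof. by elim: z => // -[x|[]] z /= IH; rewrite in_cons IH. Qed.

Lemma rank_ab z : (1 \in map rank z) = ~~ nilp (ab z).
Proof. by elim: z => // -[x|[]] z /= IH; rewrite in_cons IH. Qed.

Lemma rank_cd z : (2 \in map rank z) = (0 < cd z).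
Proof. by elim: z => // -[x|[]] z /= IH; rewrite in_cons IH. Qed.

Lemma rank_le2 z r : r \in map rank z -> r <= 2.
Proof. by case/mapP=> -[x|[]] _ ->. Qed.

Lemma ordered_after_d z t : ordered (z ++ t) -> 0 < cd z -> cc t = 0 /\ ab t = [::].
Proof.
rewrite ordered_cat -rank_cd => /andP[/allrelP H _] /H{}H; split.
  by apply/eqP; rewrite eqn0Ngt -rank_cc; apply/negP=> /H.
by apply/nilP; rewrite -[nilp _]negbK -rank_ab; apply/negP=> /H.
Qed.

Lemma ordered_after_ab z t : ordered (z ++ t) -> ab z <> [::] -> cc t = 0.
Proof.
rewrite ordered_cat => /andP[/allrelP H _] /nilP; rewrite -rank_ab => /H{}H.
by apply/eqP; rewrite eqn0Ngt -rank_cc; apply/negP=> /H.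
Qed.

Lemma ordered_before_c z t : ordered (z ++ t) -> 0 < cc t -> ab z = [::].
Proof.
move=> o c; apply: contrapT => /(ordered_after_ab o) E; by rewrite E in c.
Qed.

Lemma ordered_blockE z : ordered z -> z = block (cc z) (ab z) (cd z).
Proof.
elim: z => // x z IH; rewrite -cat1s => o.
have /IH{}IH : ordered z by move: o; rewrite ordered_cat => /and3P[].
case: x o => [x|[]] o.
- have c0 : cc z = 0 by apply: (ordered_after_ab o).
  by rewrite {1}IH /block cc_cat cd_cat ab_cat c0.
- by rewrite {1}IH.
- have [//|c0 a0] := ordered_after_d o.
  by rewrite {1}IH /block cc_cat cd_cat ab_cat c0 a0.
Qed.

Lemma ordered_block i u j : ordered (block i u j).
Proof.
have nsO n x : ordered (nseq n x).
  rewrite /ordered map_nseq (sorted_pairwise leq_trans).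
  by elim: n => //= n ->; rewrite all_nseq leqnn orbT.
have eO v : ordered (emb v).
  rewrite /ordered (sorted_pairwise leq_trans).
  by elim: v => //= x v ->; rewrite andbT all_map; elim: v.
rewrite /block !ordered_cat !nsO eO !andbT map_cat; apply/andP; split.
  by apply/allrelP=> x y; rewrite map_nseq mem_nseq => /andP[_ /eqP ->].
apply/allrelP=> x y; rewrite [X in y \in X]map_nseq mem_nseq => + /andP[_ /eqP ->].
exact: rank_le2.
Qed.

Lemma LwrapP z : Lwrap z <-> [/\ ordered z, cc z = cd z & ab z <> [::]].
Proof.
split=> [[n [w [w0 ->]]]|[/ordered_blockE E c a]].
  by rewrite -/(block n w n) ordered_block cc_block cd_block ab_block.
by exists (cc z), (ab z); split=> //; rewrite {1}E -c.
Qed.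

Lemma hwrapE z : hwrap z = (h36 (ab z), (0 < cc z, 0 < cd z)).
Proof.
rewrite /hwrap /chi /cc /cd -!has_count !has_pred1; congr pair.
elim: z => [|x z IH]; first by rewrite /hhat36 big_nil h36_nil.
rewrite /hhat36 big_cons -/(hhat36 z) IH; case: x => [x|x] /=.
  by rewrite -h36_cat.
by rewrite mul1g.
Qed.

(** An ordered word with both c and d but no middle is dead, since no letter of {a,b} can be added
    around it without breaking the order. Any other ordered word is completed by balancing the c and
    d and, if necessary, inserting an a. *)
Lemma contexts_neq0P z : contexts Lwrap z !=set0 <->
  ordered z /\ (ab z <> [::] \/ cc z = 0 \/ cd z = 0).
Proof.
split=> [[[p q] /LwrapP[/= o _ a]]|[/ordered_blockE ->]].
  have oz : ordered z by move: o; rewrite !ordered_cat => /and3P[_ _ /and3P[]].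
  split=> //; have [c0|c0] := posnP (cc z); first by right; left.
  have [d0|d0] := posnP (cd z); first by right; right.
  left=> az; apply: a; rewrite !ab_cat az.
  have -> : ab p = [::].
    by apply: (ordered_before_c o); rewrite cc_cat addn_gt0 c0.
  move: o; rewrite ordered_cat => /and3P[_ _ /ordered_after_d].
  by case/(_ d0) => _ ->.
rewrite ab_block cc_block cd_block.
have Lb n w : w <> [::] -> Lwrap (block n w n) by exists n, w.
move: (cc z) (ab z) (cd z) => i u j H.
have [u0|u0] := pselect (u = [::]); last first.
  exists (nseq j lc, nseq i ld); rewrite /contexts /=.
  have -> : nseq j lc ++ block i u j ++ nseq i ld = block (j + i) u (j + i).
    by rewrite /block !nseqD -!catA.
  exact: Lb.
case: H => [/(_ u0) //|]; rewrite u0; case=> ->.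
  exists (nseq j lc ++ [:: inl La], [::]); rewrite /contexts /= cats0 -catA.
  exact: (Lb j [:: La]).
exists ([::], inl La :: nseq i ld); rewrite /contexts /= /block /= cats0.
exact: (Lb i [:: La]).
Qed.

(** Membership of [p ++ z ++ q] in [Lwrap] depends on [z] through its order, the set of ranks
    occurring in it, and the difference of its c and d counts. [hwrap] determines the ranks; the
    difference is written additively to avoid truncated subtraction. *)
Lemma thetaP z y : contexts Lwrap z !=set0 ->
  theta Lwrap hwrap z y <->
  [/\ ordered y, hwrap z = hwrap y & cc z + cd y = cc y + cd z].
Proof.
move=> Hz; split=> [[E1 E2]|[oy E bal]].
  have /contexts_neq0P[oy _] : contexts Lwrap y !=set0 by rewrite -E1.
  (* One context shared by both words balances each of them, so their differences agree. *)
  case: Hz => -[p q] Hz; split=> //.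
  have /LwrapP[_ + _] := Hz; rewrite E1 in Hz; have /LwrapP[_ + _] := Hz.
  by rewrite !cc_cat !cd_cat; lia.
have /contexts_neq0P[oz _] := Hz; split=> //.
have half t t' : ordered t' -> hwrap t = hwrap t' -> cc t + cd t' = cc t' + cd t ->
    contexts Lwrap t `<=` contexts Lwrap t'.
  rewrite !hwrapE => ot' [Eab Ec Ed] Ebal [p q] /LwrapP/= [].
  have Enil : nilp (ab t) = nilp (ab t').
    by apply/nilP/nilP; rewrite -!h36_eq1 Eab.
  have Er : map rank t =i map rank t'.
    move=> r; have [] := leqP r 2; last first.
      by move=> r2; apply/idP/idP=> /rank_le2; rewrite leqNgt r2.
    by case: r => [|[|[|//]]] _; rewrite ?rank_cc ?rank_ab ?rank_cd ?Enil.
  rewrite !ordered_cat !cc_cat !cd_cat !ab_cat !map_cat => o c a.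
  apply/LwrapP; rewrite /= !ordered_cat !cc_cat !cd_cat !ab_cat !map_cat; split.
  - move: o; rewrite !allrel_catr (eq_allrel_memr _ _ Er) (eq_allrel_meml _ _ Er).
    by rewrite ot' => /and3P[-> -> /and3P[-> _ ->]].
  - by clear -c Ebal; lia.
  - move=> /nilP; rewrite /nilp !size_cat !addn_eq0 => /and3P[p0 t0 q0].
    apply: a; apply/nilP; rewrite /nilp !size_cat !addn_eq0 p0 q0 andbT.
    by move: Enil; rewrite /nilp t0.
by apply/seteqP; split; apply: half.
Qed.

(** * The two families of live classes *)

Definition blocks (i j : nat) (U : set (seq AB)) : set (seq Gamma) :=
  [set block i u j | u in U].

Definition wblocks (i j : nat) (s : M36) : set (seq Gamma) :=
  [set z | exists (n : nat) (u : seq AB),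
    [/\ 1 <= n, Mlang s u & z = block (i + n) u (j + n)]].

(** One of the two counts vanishes and [hwrap] records which, so the difference determines both and
    only the middle can vary. *)
Lemma rel_class_block i u j : i = 0 \/ j = 0 ->
  rel_class Lwrap hwrap (block i u j) = blocks i j (fiber (h36 u)).
Proof.
move=> ij; have Hl : contexts Lwrap (block i u j) !=set0.
  by apply/contexts_neq0P; rewrite ordered_block cc_block cd_block; split=> //; right.
apply/seteqP; split=> [y /(thetaP _ Hl)[oy]|y].
  rewrite !hwrapE cc_block cd_block ab_block => -[Eu Ec Ed] bal.
  exists (ab y); first by rewrite /fiber /= Eu.
  by rewrite [RHS](ordered_blockE oy); congr block; case: ij => ij; subst; lia.
case=> v Ev <-; apply/thetaP => //.
by rewrite ordered_block !hwrapE !ab_block !cc_block !cd_block Ev.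
Qed.

(** Once both counts are positive, [hwrap] no longer distinguishes their values. Only their
    difference is fixed and the nesting depth is free. *)
Lemma rel_class_wblocks i u j n : i = 0 \/ j = 0 -> 0 < n -> u <> [::] ->
  rel_class Lwrap hwrap (block (i + n) u (j + n)) = wblocks i j (h36 u).
Proof.
move=> ij n0 u0; have Hl : contexts Lwrap (block (i + n) u (j + n)) !=set0.
  by apply/contexts_neq0P; rewrite ordered_block ab_block; split=> //; left.
have ME v : Mlang (h36 u) v <-> h36 v = h36 u.
  by rewrite Mlang_fiber // h36_eq1.
apply/seteqP; split=> [y /(thetaP _ Hl)[oy]|y].
  rewrite !hwrapE cc_block cd_block ab_block => -[Eu Ec Ed] bal.
  exists (minn (cc y) (cd y)), (ab y); split; [lia|exact/ME|].
  by rewrite [LHS](ordered_blockE oy); congr block; case: ij => ij; subst; lia.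
case=> m [v [m0 /ME Ev ->]]; apply/thetaP => //.
rewrite ordered_block !hwrapE !ab_block !cc_block !cd_block Ev.
by split=> //; [congr (_, (_, _)); lia|lia].
Qed.

Lemma blocks_class i j s : i = 0 \/ j = 0 ->
  is_rel_class Lwrap hwrap (blocks i j (fiber s)).
Proof.
by move=> ij; have [u <-] := h36_surj s; exists (block i u j); rewrite rel_class_block.
Qed.

Lemma wblocks_class i j (s : M36) : s <> 1%g -> i = 0 \/ j = 0 ->
  is_rel_class Lwrap hwrap (wblocks i j s).
Proof.
move=> s1 ij; have [u Eu] := h36_surj s; exists (block (i + 1) u (j + 1)).
by rewrite rel_class_wblocks ?Eu // => /h36_eq1; rewrite Eu.
Qed.

Lemma blocks_live i j s : i = 0 \/ j = 0 -> live Lwrap (blocks i j (fiber s)).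
Proof.
move=> ij; have [u Eu] := h36_surj s; exists (block i u j); first by exists u.
by apply/contexts_neq0P; rewrite ordered_block cc_block cd_block; split=> //; right.
Qed.

Lemma Mlang_neq0 (s : M36) : s <> 1%g -> Mlang s !=set0.
Proof. by move=> s1; rewrite Mlang_fiber //; apply: fiber_neq0. Qed.

Lemma wblocks_live i j (s : M36) : s <> 1%g -> live Lwrap (wblocks i j s).
Proof.
move=> /Mlang_neq0[u Hu]; exists (block (i + 1) u (j + 1)); first by exists 1, u.
by apply/contexts_neq0P; rewrite ordered_block ab_block; split=> //; left; case: Hu.
Qed.

Lemma unit_classE : unit_class Lwrap hwrap = blocks 0 0 (fiber 1%g).
Proof. by rewrite -h36_nil -rel_class_block; [|left]. Qed.

Lemma live_classP X : is_rel_class Lwrap hwrap X -> live Lwrap X ->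
  exists i j s, (i = 0 \/ j = 0) /\
    (X = blocks i j (fiber s) \/ s <> 1%g /\ X = wblocks i j s).
Proof.
case=> x -> [y [Exy _]]; rewrite -{}Exy => /contexts_neq0P[/ordered_blockE ->].
move: (cc x) (ab x) (cd x) => i u j; rewrite ab_block cc_block cd_block => H.
have [ij|ij] := pselect (i = 0 \/ j = 0).
  by exists i, j, (h36 u); rewrite rel_class_block //; split=> //; left.
have u0 : u <> [::] by case: H.
(* The common part [minn i j] is the positive nesting depth; removing it leaves an excess on at most
   one side. *)
exists (i - minn i j), (j - minn i j), (h36 u); split; first by lia.
right; split; first by move/h36_eq1.
rewrite -(@rel_class_wblocks _ u _ (minn i j)) //; try lia.
by congr (rel_class _ _ (block _ _ _)); lia.
Qed.

Lemma blocks_inj i j i' j' U V : U !=set0 ->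
  blocks i j U = blocks i' j' V -> [/\ i = i', j = j' & U = V].
Proof.
move=> [u Uu] E; have : blocks i' j' V (block i u j) by rewrite -E; exists u.
case=> v _ Ev.
have Ei : i = i' by rewrite -(cc_block i u j) -Ev cc_block.
have Ej : j = j' by rewrite -(cd_block i u j) -Ev cd_block.
subst i' j'; split=> //; apply/seteqP; split=> w Hw.
  have : blocks i j V (block i w j) by rewrite -E; exists w.
  by case=> t Vt /(congr1 ab); rewrite !ab_block => <-.
have : blocks i j U (block i w j) by rewrite E; exists w.
by case=> t Vt /(congr1 ab); rewrite !ab_block => <-.
Qed.

Lemma wblocks_inj i j (s : M36) i' j' (s' : M36) : s <> 1%g -> s' <> 1%g ->
  wblocks i j s = wblocks i' j' s' -> [/\ i = i', j = j' & s = s'].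
Proof.
move=> /Mlang_neq0[u Hu] /Mlang_neq0[v Hv] E.
have : wblocks i' j' s' (block (i + 1) u (j + 1)) by rewrite -E; exists 1, u.
have : wblocks i j s (block (i' + 1) v (j' + 1)) by rewrite E; exists 1, v.
case=> n [v' [n0 _ Ev]] [m [u' [m0 [_ <-] Eu]]].
have := congr1 cc Ev; have := congr1 cc Eu; rewrite !cc_block.
have := congr1 cd Ev; have := congr1 cd Eu; rewrite !cd_block.
have := congr1 ab Eu; rewrite !ab_block => <-; case: Hu => _ <-.
by split=> //; lia.
Qed.

(** The number of c is constant on [blocks] but takes both values [i' + 1] and [i' + 2] on
    [wblocks]. *)
Lemma blocks_wblocks i j U i' j' (s : M36) : s <> 1%g -> blocks i j U <> wblocks i' j' s.
Proof.
move=> /Mlang_neq0[u Hu] E.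
have H n : 0 < n -> i = i' + n.
  move=> n0; have : blocks i j U (block (i' + n) u (j' + n)) by rewrite E; exists n, u.
  by case=> v _ /(congr1 cc); rewrite !cc_block.
by have := H 1 isT; have := H 2 isT; lia.
Qed.

Lemma nseqc_block n i u j : nseq n lc ++ block i u j = block (n + i) u j.
Proof. by rewrite /block nseqD -catA. Qed.

Lemma block_nseqd i u j n : block i u j ++ nseq n ld = block i u (j + n).
Proof. by rewrite /block nseqD -!catA. Qed.

Lemma nseqc_blocks n i j U :
  lang_mul [set nseq n lc] (blocks i j U) = blocks (n + i) j U.
Proof.
apply/seteqP; split=> [_ [_ [_ [-> [u Uu <-] ->]]]|_ [u Uu <-]].
  by rewrite nseqc_block; exists u.
by rewrite -nseqc_block; exists (nseq n lc), (block i u j); split=> //; exists u.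
Qed.

Lemma blocks_nseqd n i j U :
  lang_mul (blocks i j U) [set nseq n ld] = blocks i (j + n) U.
Proof.
apply/seteqP; split=> [_ [_ [_ [[u Uu <-] -> ->]]]|_ [u Uu <-]].
  by rewrite block_nseqd; exists u.
by rewrite -block_nseqd; exists (block i u j), (nseq n ld); split=> //; exists u.
Qed.

Lemma nseqc_wblocks n i j s :
  lang_mul [set nseq n lc] (wblocks i j s) = wblocks (n + i) j s.
Proof.
apply/seteqP; split=> [_ [_ [_ [-> [m [u [m0 Hu ->]] ->]]]]|_ [m [u [m0 Hu ->]]]].
  by rewrite nseqc_block addnA; exists m, u.
exists (nseq n lc), (block (i + m) u (j + m)); rewrite nseqc_block addnA.
by split=> //; exists m, u.
Qed.

Lemma wblocks_nseqd n i j s :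
  lang_mul (wblocks i j s) [set nseq n ld] = wblocks i (j + n) s.
Proof.
apply/seteqP; split=> [_ [_ [_ [[m [u [m0 Hu ->]]] -> ->]]]|_ [m [u [m0 Hu ->]]]].
  by rewrite block_nseqd addnAC; exists m, u.
exists (block (i + m) u (j + m)), (nseq n ld); rewrite block_nseqd addnAC.
by split=> //; exists m, u.
Qed.

Lemma block0 u : block 0 u 0 = emb u.
Proof. exact: cats0. Qed.

Lemma blocks0_mul U V :
  lang_mul (blocks 0 0 U) (blocks 0 0 V) = blocks 0 0 (lang_mul U V).
Proof.
apply/seteqP; split=> [_ [_ [_ [[u Uu <-] [v Vv <-] ->]]]|_ [_ [u [v [Uu Vv ->]]] <-]].
  by exists (u ++ v); [exists u, v|rewrite !block0 /emb map_cat].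
exists (block 0 u 0), (block 0 v 0); split; [by exists u|by exists v|].
by rewrite !block0 /emb map_cat.
Qed.

Lemma Mwrap_blocks s : Mwrap s = blocks 0 0 (Mlang s).
Proof.
by apply/seteqP; split=> _ [u Hu <-]; exists u => //; rewrite block0.
Qed.

Lemma Clang_blocks : Clang = blocks 1 0 (fiber 1%g).
Proof.
rewrite fiber1; apply/seteqP; split=> [_ ->|_ [_ -> <-] //].
by exists [::].
Qed.

Lemma Dlang_blocks : Dlang = blocks 0 1 (fiber 1%g).
Proof.
rewrite fiber1; apply/seteqP; split=> [_ ->|_ [_ -> <-] //].
by exists [::].
Qed.

Lemma rel_class_mem X x : is_rel_class Lwrap hwrap X -> X x -> X = rel_class Lwrap hwrap x.
Proof.
case=> y -> [E1 E2]; apply/seteqP; split=> z [H1 H2]; split.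
- by rewrite -E1.
- by rewrite -E2.
- by rewrite E1.
- by rewrite E2.
Qed.

Lemma unit_class_mem X : is_rel_class Lwrap hwrap X -> X [::] -> X = unit_class Lwrap hwrap.
Proof. exact: rel_class_mem. Qed.

(** * Relative primes of the wrapped language *)

Lemma letter_rel_prime x : is_rel_class Lwrap hwrap [set [:: x]] ->
  live Lwrap [set [:: x]] -> rel_prime Lwrap hwrap [set [:: x]].
Proof.
move=> cx lx; split=> //.
  move=> E; have : unit_class Lwrap hwrap [::] by [].
  by rewrite -E.
move=> X Y HX HY E; have : lang_mul X Y [:: x] by rewrite -E.
case=> -[|y u] [v [Xu Yv]]; first by left; apply: unit_class_mem.
by case: u Xu => [|//] Xu [_ /esym v0]; right; apply: unit_class_mem; rewrite -?v0.
Qed.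

Lemma Clang_rel_prime : rel_prime Lwrap hwrap Clang.
Proof.
by apply: letter_rel_prime; rewrite -/Clang Clang_blocks;
  [apply: blocks_class|apply: blocks_live]; right.
Qed.

Lemma Dlang_rel_prime : rel_prime Lwrap hwrap Dlang.
Proof.
by apply: letter_rel_prime; rewrite -/Dlang Dlang_blocks;
  [apply: blocks_class|apply: blocks_live]; left.
Qed.

(** Splitting one word over {a,b} shows that both factor classes contain words over {a,b}. They are
    therefore embedded fibers, and primality for [Lplus] applies. *)
Lemma Mwrap_rel_prime s : P36 s -> rel_prime Lwrap hwrap (Mwrap s).
Proof.
move=> [s1 /(rel_prime_LplusP s1) H]; rewrite Mwrap_blocks Mlang_fiber //.
split; [by apply: blocks_class; left|by apply: blocks_live; left| |].
  by rewrite unit_classE => /(blocks_inj (fiber_neq0 _))[_ _ /fiber_inj].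
move=> X Y HX HY E; have [u Hu] := fiber_neq0 s.
have : lang_mul X Y (block 0 u 0) by rewrite -E; exists u.
case=> x [y [Xx Yy Exy]].
have /andP[ox oy] : ordered x && ordered y.
  by have := ordered_block 0 u 0; rewrite Exy ordered_cat => /and3P[_ -> ->].
have := congr1 cc Exy; have := congr1 cd Exy.
rewrite cc_block cd_block cc_cat cd_cat => dxy cxy.
have xE : x = block 0 (ab x) 0.
  by rewrite [LHS](ordered_blockE ox); congr block; lia.
have yE : y = block 0 (ab y) 0.
  by rewrite [LHS](ordered_blockE oy); congr block; lia.
move: E; rewrite (rel_class_mem HX Xx) (rel_class_mem HY Yy) xE yE.
rewrite !rel_class_block; try by left.
rewrite blocks0_mul => /(blocks_inj (fiber_neq0 _))[_ _ /H].
by rewrite unit_classE; case=> ->; [left|right].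
Qed.

Lemma Wwrap_rel_prime (s : M36) : s <> 1%g -> rel_prime Lwrap hwrap (Wwrap s).
Proof.
move=> s1; rewrite -[Wwrap s]/(wblocks 0 0 s); have [u Hu] := Mlang_neq0 s1.
split; [by apply: wblocks_class => //; left|exact: wblocks_live| |].
  by rewrite unit_classE => /esym; apply: blocks_wblocks.
move=> X Y HX HY E.
have [->|X1] := pselect (X = unit_class Lwrap hwrap); first by left.
have [->|Y1] := pselect (Y = unit_class Lwrap hwrap); first by right.
have W n : 0 < n -> lang_mul X Y (block n u n) by move=> n0; rewrite -E; exists n, u.
have [x [y [Xx Yy Exy]]] := W 1 isT; have [x' [y' [Xx' Yy' Exy']]] := W 2 isT.
have cx : 0 < cc x.
  case: x Xx Exy => [|z x] Xx; first by case: X1; apply: unit_class_mem.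
  by case=> <-.
have dy : 0 < cd y.
  case/lastP: y Yy Exy => [|y z] Yy; first by case: Y1; apply: unit_class_mem.
  rewrite -rcons_cat -[block 1 u 1]/(lc :: (emb u ++ [:: ld])) cats1 -rcons_cons.
  by move=> /rcons_inj[_ <-]; rewrite -cats1 cd_cat addn1.
have := congr1 cc Exy; have := congr1 cd Exy.
have := congr1 cc Exy'; rewrite !cc_block !cd_block !cc_cat !cd_cat => c2 d1 c1.
have : rel_class Lwrap hwrap x x' by rewrite -(rel_class_mem HX).
have : rel_class Lwrap hwrap y y' by rewrite -(rel_class_mem HY).
case=> _; rewrite !hwrapE => -[_ cy dy'] [_]; rewrite !hwrapE => -[_ cx' dx].
(* Here [x'] has two c and no d, while [y] has one d and no c. Their concatenation is unbalanced,
   although all words of this class are balanced. *)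
have : wblocks 0 0 s (x' ++ y) by rewrite E; exists x', y.
case=> n [v [n0 _ Ev]]; have := congr1 cc Ev; have := congr1 cd Ev.
by rewrite !cc_block !cd_block !cc_cat !cd_cat; lia.
Qed.

Lemma rel_prime_Pwrap P : rel_prime Lwrap hwrap P <-> Pwrap P.
Proof.
split; last first.
  case=> [[[->|->]|[s Hs <-]]|[s s1 <-]].
  - exact: Clang_rel_prime.
  - exact: Dlang_rel_prime.
  - exact: Mwrap_rel_prime.
  - exact: Wwrap_rel_prime.
case=> HP /(live_classP HP)[i [j [s [ij PE]]]].
have ClangU : Clang <> unit_class Lwrap hwrap by have [] := Clang_rel_prime.
have DlangU : Dlang <> unit_class Lwrap hwrap by have [] := Dlang_rel_prime.
have ClangC : is_rel_class Lwrap hwrap Clang by have [] := Clang_rel_prime.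
have DlangC : is_rel_class Lwrap hwrap Dlang by have [] := Dlang_rel_prime.
rewrite {HP}; case: PE => [->|[s1 ->]] Pu Pd; last first.
  have unit_wblocks i' j' : wblocks i' j' s <> unit_class Lwrap hwrap.
    by rewrite unit_classE => /esym; apply: blocks_wblocks.
  (* An excess c or d can be split off as a factor [Clang] or [Dlang]. The other factor is still
     nested, hence not the unit, so a prime has no excess. *)
  case: i j ij Pu Pd => [|i] [|j] // ij Pu Pd.
  - by right; exists s.
  - have E : wblocks 0 j.+1 s = lang_mul (wblocks 0 j s) Dlang.
      by rewrite -[Dlang]/[set nseq 1 ld] wblocks_nseqd addn1.
    have [] := Pd _ _ (wblocks_class s1 (or_introl erefl)) DlangC E.
      by move/unit_wblocks.
    by move/DlangU.
  - have E : wblocks i.+1 0 s = lang_mul Clang (wblocks i 0 s).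
      by rewrite -[Clang]/[set nseq 1 lc] nseqc_wblocks add1n.
    have [] := Pd _ _ ClangC (wblocks_class s1 (or_intror erefl)) E.
      by move/ClangU.
    by move/unit_wblocks.
  - by case: ij.
case: i j ij Pu Pd => [|i] [|j] // ij Pu Pd; last by case: ij.
- have s1 : s <> 1%g by move=> s1; apply: Pu; rewrite unit_classE s1.
  left; right; exists s; last by rewrite Mwrap_blocks Mlang_fiber.
  split=> //; apply/rel_prime_LplusP => // t u E.
  have := Pd (blocks 0 0 (fiber t)) (blocks 0 0 (fiber u))
    (blocks_class _ (or_introl erefl)) (blocks_class _ (or_introl erefl)).
  rewrite blocks0_mul -E unit_classE => /(_ erefl).
  by case=> /(blocks_inj (fiber_neq0 _))[_ _ /fiber_inj ->]; [left|right].
(* Without nesting the same splitting is possible, but the remaining factor may be the unit; this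
   leaves exactly [Dlang], and [Clang] in the symmetric case. *)
- have E : blocks 0 j.+1 (fiber s) = lang_mul (blocks 0 j (fiber s)) Dlang.
    by rewrite -[Dlang]/[set nseq 1 ld] blocks_nseqd addn1.
  have [] := Pd _ _ (blocks_class _ (or_introl erefl)) DlangC E.
    rewrite unit_classE => /(blocks_inj (fiber_neq0 _))[_ -> /fiber_inj ->].
    by left; left; right; rewrite Dlang_blocks.
  by move/DlangU.
- have E : blocks i.+1 0 (fiber s) = lang_mul Clang (blocks i 0 (fiber s)).
    by rewrite -[Clang]/[set nseq 1 lc] nseqc_blocks add1n.
  have [] := Pd _ _ ClangC (blocks_class _ (or_intror erefl)) E.
    by move/ClangU.
  rewrite unit_classE => /(blocks_inj (fiber_neq0 _))[-> _ /fiber_inj ->].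
  by left; left; left; rewrite Clang_blocks.
Qed.

(** * Factorizations and cardinalities *)

Lemma lang_prod_nseq (Sigma : finType) (x : Sigma) n :
  lang_prod (nseq n [set [:: x]]) = [set nseq n x].
Proof.
elim: n => //= n ->; apply/seteqP; split=> [_ [_ [_ [-> -> ->]]] //|_ ->].
by exists [:: x], (nseq n x).
Qed.

Lemma lang_prod_Mwrap ps :
  lang_prod (map Mwrap ps) = blocks 0 0 (lang_prod (map Mlang ps)).
Proof.
elim: ps => [|p ps IH] /=.
  apply/seteqP; split=> [_ ->|_ [_ -> <-] //].
  by exists [::].
by rewrite -/(lang_prod _) IH Mwrap_blocks blocks0_mul.
Qed.

Definition plain_word i (ps : seq M36) j : seq (set (seq Gamma)) :=
  nseq i Clang ++ map Mwrap ps ++ nseq j Dlang.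

Definition nested_word i (s : M36) j : seq (set (seq Gamma)) :=
  nseq i Clang ++ Wwrap s :: nseq j Dlang.

Lemma lang_prod_plain i ps j :
  lang_prod (plain_word i ps j) = blocks i j (lang_prod (map Mlang ps)).
Proof.
rewrite !lang_prod_cat lang_prod_Mwrap !lang_prod_nseq blocks_nseqd.
by rewrite nseqc_blocks addn0.
Qed.

Lemma lang_prod_nested i s j : lang_prod (nested_word i s j) = wblocks i j s.
Proof.
rewrite lang_prod_cat /= -/(lang_prod _) !lang_prod_nseq.
by rewrite -[Wwrap s]/(wblocks 0 0 s) wblocks_nseqd nseqc_wblocks addn0.
Qed.

Lemma Mlang_prod_nil ps : lang_prod (map Mlang ps) [::] -> ps = [::].
Proof. by case: ps => // p ps [[|x u] [v [[]]]]. Qed.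

Lemma Mlang_prod_neq0 ps : {in ps, forall p, P36 p} ->
  lang_prod (map Mlang ps) !=set0.
Proof.
elim: ps => [|p ps IH] H; first by exists [::].
have [|v Hv] := IH; first by move=> q qp; apply: H; rewrite in_cons qp orbT.
have [p1 _] := H p (mem_head _ _); have [u Hu] := Mlang_neq0 p1.
by exists (u ++ v), u, v.
Qed.

(* The order c < {a,b} < d is respected by every live word, so the prime
   factors must occur in that order, and a Wwrap s excludes all other blocks. *)
Lemma Pwrap_word_shape l : {in l, forall P, Pwrap P} ->
  (forall z, lang_prod l z -> ordered z) ->
  (exists i ps j, {in ps, forall p, P36 p} /\ l = plain_word i ps j) \/
  (exists i (s : M36) j, s <> 1%g /\ l = nested_word i s j).
Proof.
elim: l => [_ _|P l IH HP Ho]; first by left; exists 0, [::], 0.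
have HPP : Pwrap P by apply: HP; apply: mem_head.
have [x Px] : exists x, P x.
  by have /rel_prime_Pwrap[_ [x Px _] _ _] := HPP; exists x.
have Hxy x' y : P x' -> lang_prod l y -> ordered (x' ++ y).
  by move=> Px' ly; apply: Ho; exists x', y.
have {}IH : (exists i ps j, {in ps, forall p, P36 p} /\ l = plain_word i ps j) \/
  (exists i (s : M36) j, s <> 1%g /\ l = nested_word i s j).
  apply: IH => [Q Ql|z lz]; first by apply: HP; rewrite in_cons Ql orbT.
  by have := Hxy x z Px lz; rewrite ordered_cat => /and3P[].
(* These three facts turn the restrictions that the head imposes on the tail into its shape: a
   nested tail always contains c, and a plain tail free of c, or of both c and {a,b}, loses the
   corresponding factors. *)
have nested_c i (s : M36) j : s <> 1%g -> l = nested_word i s j ->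
    exists2 y, lang_prod l y & 0 < cc y.
  move=> /Mlang_neq0[u Hu] ->; exists (block (i + 1) u (j + 1)).
    by rewrite lang_prod_nested; exists 1, u.
  by rewrite cc_block addn1.
have plain_c i ps j : {in ps, forall p, P36 p} -> l = plain_word i ps j ->
    (forall y, lang_prod l y -> cc y = 0) -> i = 0.
  move=> /Mlang_prod_neq0[u Hu] -> /(_ (block i u j)); rewrite cc_block; apply.
  by rewrite lang_prod_plain; exists u.
have plain_cd i ps j : {in ps, forall p, P36 p} -> l = plain_word i ps j ->
    (forall y, lang_prod l y -> cc y = 0 /\ ab y = [::]) -> i = 0 /\ ps = [::].
  move=> Hps E H; split; first by apply: (plain_c _ _ _ Hps E) => y /H[].
  have [u Hu] := Mlang_prod_neq0 Hps; apply: Mlang_prod_nil.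
  have [|_] := H (block i u j); first by rewrite E lang_prod_plain; exists u.
  by rewrite ab_block => u0; rewrite -u0.
case: HPP => [[[PE|PE]|[p Hp PE]]|[s s1 PE]].
- rewrite PE; case: IH => [[i [ps [j [Hps ->]]]]|[i [s [j [s1 ->]]]]].
    by left; exists i.+1, ps, j.
  by right; exists i.+1, s, j.
- have Hl y : lang_prod l y -> cc y = 0 /\ ab y = [::].
    by move=> ly; apply: (ordered_after_d (Hxy [:: ld] y _ ly)); rewrite ?PE.
  case: IH => [[i [ps [j [Hps E]]]]|[i [s [j [s1 /(nested_c _ _ _ s1)[y /Hl[-> _]]]]]]] //.
  have [i0 ps0] := plain_cd _ _ _ Hps E Hl.
  by left; exists 0, [::], j.+1; rewrite PE E i0 ps0.
- have Hl y : lang_prod l y -> cc y = 0.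
    have [p1 _] := Hp; have [u Hu] := Mlang_neq0 p1 => ly.
    apply: (@ordered_after_ab (block 0 u 0)); last by rewrite ab_block; case: Hu.
    by apply: Hxy => //; rewrite -PE block0; exists u.
  case: IH => [[i [ps [j [Hps E]]]]|[i [s [j [s1 /(nested_c _ _ _ s1)[y /Hl-> //]]]]]].
  left; exists 0, (p :: ps), j; rewrite E (plain_c _ _ _ Hps E Hl) -PE; split=> //.
  by move=> q; rewrite in_cons => /predU1P[->|/Hps].
- have Hl y : lang_prod l y -> cc y = 0 /\ ab y = [::].
    have [u Hu] := Mlang_neq0 s1 => ly; apply: (@ordered_after_d (block 1 u 1)).
      by apply: Hxy => //; rewrite -PE; exists 1, u.
    by rewrite cd_block.
  case: IH => [[i [ps [j [Hps E]]]]|[i [t [j [t1 /(nested_c _ _ _ t1)[y /Hl[-> _]]]]]]] //.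
  have [i0 ps0] := plain_cd _ _ _ Hps E Hl.
  by right; exists 0, s, j; rewrite -PE E i0 ps0.
Qed.

Lemma map_Mlang_fiber ps : {in ps, forall p, P36 p} -> map Mlang ps = map fiber ps.
Proof. by move=> H; apply/eq_in_map => p /H[p1 _]; rewrite Mlang_fiber. Qed.

Lemma exact_factorization_exists X : is_rel_class Lwrap hwrap X -> live Lwrap X ->
  X <> unit_class Lwrap hwrap -> exists l, exact_factorization Lwrap hwrap X l.
Proof.
move=> HX /(live_classP HX)[i [j [s [ij XE]]]] X1.
suff [l Hl El] : exists2 l, {in l, forall P, Pwrap P} & lang_prod l = X.
  exists l; split=> [l0|P /Hl/rel_prime_Pwrap //|//].
  by apply: X1; rewrite -El l0 unit_classE fiber1; apply/seteqP;
    split=> [_ ->|_ [_ -> <-] //]; exists [::].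
have mem_nseqP (Y P : set (seq Gamma)) n : P \in nseq n Y -> P = Y.
  by rewrite mem_nseq => /andP[_ /eqP].
case: XE => [->|[s1 ->]].
  have [ps [Hps Eps]] := fiber_factorization_exists s.
  exists (plain_word i ps j); last by rewrite lang_prod_plain map_Mlang_fiber ?Eps.
  move=> P; rewrite !mem_cat => /or3P[/mem_nseqP->|/mapP[p /Hps Hp ->]|/mem_nseqP->].
  - by left; left; left.
  - by left; right; exists p.
  - by left; left; right.
exists (nested_word i s j); last exact: lang_prod_nested.
move=> P; rewrite mem_cat in_cons => /or3P[/mem_nseqP->|/eqP ->|/mem_nseqP->].
- by left; left; left.
- by right; exists s.
- by left; left; right.
Qed.

Lemma exact_factorization_shape X l : is_rel_class Lwrap hwrap X -> live Lwrap X ->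
  exact_factorization Lwrap hwrap X l ->
  (exists i ps j, [/\ {in ps, forall p, P36 p}, l = plain_word i ps j &
     X = blocks i j (lang_prod (map fiber ps))]) \/
  (exists i (s : M36) j, [/\ s <> 1%g, l = nested_word i s j & X = wblocks i j s]).
Proof.
move=> HX LX [_ Hl EX].
have ord z : X z -> ordered z.
  move=> Xz; have [i [j [s [_ []]]]] := live_classP HX LX.
    by move=> E; move: Xz; rewrite E => -[u _ <-]; apply: ordered_block.
  by case=> _ E; move: Xz; rewrite E => -[n [u [_ _ ->]]]; apply: ordered_block.
have [P Pl|z lz||] := @Pwrap_word_shape l.
- exact/rel_prime_Pwrap/Hl.
- by apply: ord; rewrite EX.
- case=> i [ps [j [Hps E]]]; left; exists i, ps, j; split=> //.
  by rewrite EX -/(lang_prod l) E lang_prod_plain map_Mlang_fiber.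
- case=> i [s [j [s1 E]]]; right; exists i, s, j; split=> //.
  by rewrite EX -/(lang_prod l) E lang_prod_nested.
Qed.

Lemma exact_factorization_unique X l l' :
  is_rel_class Lwrap hwrap X -> live Lwrap X ->
  exact_factorization Lwrap hwrap X l -> exact_factorization Lwrap hwrap X l' -> l = l'.
Proof.
move=> HX LX Hl Hl'.
case: (exact_factorization_shape HX LX Hl) => [[i [ps [j [Hps -> E]]]]|[i [s [j [s1 -> E]]]]];
case: (exact_factorization_shape HX LX Hl') =>
  [[i' [ps' [j' [Hps' -> E']]]]|[i' [s' [j' [s1' -> E']]]]].
- have neq0 : lang_prod (map fiber ps) !=set0.
    by rewrite -map_Mlang_fiber //; apply: Mlang_prod_neq0.
  move: (E'); rewrite E => /(blocks_inj neq0)[-> -> Eps].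
  (* Uniqueness over {a,b} concerns factorizations of a single fiber; that the middle product is one
     follows from [X] being a live class. *)
  have [i1 [j1 [s [_ [Es|[s1 Es]]]]]] := live_classP HX LX.
    move: Es; rewrite E => /(blocks_inj neq0)[_ _ Es].
    by rewrite (fiber_factorization_unique Hps Hps' Es) // -Eps.
  by case: (blocks_wblocks s1 (etrans (esym E) Es)).
- by case: (blocks_wblocks s1' (etrans (esym E) E')).
- by case: (blocks_wblocks s1 (etrans (esym E') E)).
- by have [-> -> ->] := wblocks_inj s1 s1' (etrans (esym E) E').
Qed.

(** * Counting the primes *)

Lemma card_eq_seq (T : eqType) (s : seq T) : uniq s -> [set x | x \in s] #= `I_(size s).
Proof.
case: s => [|x0 s] us; first by rewrite /= II0 (_ : [set _ | _] = set0) //; apply/seteqP; split.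
set t := x0 :: s; have -> : [set x | x \in t] = nth x0 t @` `I_(size t).
  apply/seteqP; split=> [x /(nthP x0)[i Hi <-]|_ [i Hi <-]]; first by exists i.
  exact: mem_nth.
apply: inj_card_eq => i j; rewrite !inE => Hi Hj /eqP.
by rewrite nth_uniq // => /eqP.
Qed.

Definition Mwrap_primes : seq (set (seq Gamma)) := [seq Mwrap (elt i) | i <- prime_codes].
Definition Wwrap_primes : seq (set (seq Gamma)) := [seq Wwrap (elt i) | i <- iota 1 35].

Lemma Mwrap_primesE : Mwrap @` P36 = [set P | P \in Mwrap_primes].
Proof.
apply/seteqP; split=> [_ [s /P36P[i iP <-] <-]|_ /mapP[i iP ->]].
  by apply/mapP; exists i.
by exists (elt i) => //; apply/P36P; exists i.
Qed.

Lemma Wwrap_primesE : Wwrap @` [set s | s <> 1%g] = [set P | P \in Wwrap_primes].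
Proof.
apply/seteqP; split=> [_ [s /elt_surj_neq1[i Hi <-] <-]|P /mapP[i Hi ->]].
  by apply/mapP; exists i; rewrite // mem_iota.
by exists (elt i) => //; apply: elt_neq1; rewrite mem_iota in Hi.
Qed.

Lemma uniq_Mwrap_primes : uniq Mwrap_primes.
Proof.
rewrite map_inj_in_uniq // => i j iP jP.
have Hi := prime_code_bounds iP; have Hj := prime_code_bounds jP.
rewrite !Mwrap_blocks !Mlang_fiber; try exact: elt_neq1.
case/(blocks_inj (fiber_neq0 _))=> _ _ /fiber_inj/elt_inj; rewrite !inE.
by case/andP: Hi Hj => _ -> /andP[_ ->]; apply.
Qed.

Lemma uniq_Wwrap_primes : uniq Wwrap_primes.
Proof.
rewrite map_inj_in_uniq ?iota_uniq // => i j; rewrite !mem_iota => Hi Hj.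
case/(@wblocks_inj 0 0 _ 0 0 _ (elt_neq1 Hi) (elt_neq1 Hj)) => _ _ /elt_inj.
by rewrite !inE; case/andP: Hi Hj => _ -> /andP[_ ->]; apply.
Qed.

Lemma uniq_CD : uniq [:: Clang; Dlang].
Proof.
rewrite /= andbT mem_seq1; apply/eqP; rewrite Clang_blocks Dlang_blocks.
by case/(blocks_inj (fiber_neq0 _)).
Qed.

Definition Pwrap_seq := [:: Clang; Dlang] ++ Mwrap_primes ++ Wwrap_primes.

Lemma Pwrap_seqE : Pwrap = [set P | P \in Pwrap_seq].
Proof.
rewrite /Pwrap Mwrap_primesE Wwrap_primesE.
have memE P : (P \in Pwrap_seq) =
    [|| P == Clang, P == Dlang, P \in Mwrap_primes | P \in Wwrap_primes].
  by rewrite !mem_cat !in_cons orbF -orbA.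
apply/seteqP; split=> P HP.
  suff : P \in Pwrap_seq by []; rewrite memE.
  case: HP => [[[->|->]|HP]|HP]; apply/or4P.
  - exact: Or41 (eqxx _).
  - exact: Or42 (eqxx _).
  - exact: Or43 HP.
  - exact: Or44 HP.
have : P \in Pwrap_seq by []; rewrite memE.
case/or4P=> [/eqP->|/eqP->|HP'|HP'].
- by left; left; left.
- by left; left; right.
- by left; right.
- by right.
Qed.

(** [Clang], [Dlang] and the [Mwrap] classes are [blocks] with different excesses, and the [Wwrap]
    classes are [wblocks], so the groups are disjoint. *)
Lemma uniq_Pwrap_seq : uniq Pwrap_seq.
Proof.
have WB P : P \in Wwrap_primes -> forall i j U, P <> blocks i j U.
  case/mapP=> k; rewrite mem_iota => Hk -> i j U /esym.
  exact: (@blocks_wblocks i j U 0 0 _ (elt_neq1 Hk)).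
rewrite /Pwrap_seq !cat_uniq uniq_CD uniq_Mwrap_primes uniq_Wwrap_primes andbT !andTb.
apply/andP; split; last first.
  apply/hasPn=> P /WB HP; apply/negP=> /mapP[i _].
  by rewrite Mwrap_blocks; apply: HP.
apply/hasPn=> P; rewrite mem_cat => /orP[/mapP[i /prime_code_bounds Hi ->]|/WB HP].
  rewrite Mwrap_blocks Mlang_fiber; last exact: elt_neq1.
  rewrite !in_cons orbF Clang_blocks Dlang_blocks.
  by apply/negP=> /orP[]/eqP/(blocks_inj (fiber_neq0 _))[].
rewrite !in_cons orbF Clang_blocks Dlang_blocks.
by apply/negP=> /orP[]/eqP/HP.
Qed.

Theorem theorem13p3 :
  [/\ [set P | rel_prime Lwrap hwrap P] = Pwrap,
      [/\ [set Clang; Dlang] #= `I_2, Mwrap @` P36 #= `I_15,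
          Wwrap @` [set s | s <> 1%g] #= `I_35 &
          Pwrap #= `I_52] &
      forall X : set (seq Gamma),
        is_rel_class Lwrap hwrap X -> live Lwrap X ->
        X <> unit_class Lwrap hwrap ->
        exists! s : seq (set (seq Gamma)), exact_factorization Lwrap hwrap X s].
Proof.
split.
- by apply/seteqP; split=> P /rel_prime_Pwrap.
- split.
  + have -> : [set Clang; Dlang] = [set P | P \in [:: Clang; Dlang]].
      apply/seteqP; split=> P /=; rewrite !in_cons orbF.
        by case=> ->; rewrite eqxx ?orbT.
      by case/orP=> /eqP ->; [left|right].
    exact: card_eq_seq uniq_CD.
  + by rewrite Mwrap_primesE; apply: card_eq_seq uniq_Mwrap_primes.
  + by rewrite Wwrap_primesE; apply: card_eq_seq uniq_Wwrap_primes.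
  + by rewrite Pwrap_seqE; apply: card_eq_seq uniq_Pwrap_seq.
move=> X HX LX X1; have [l Hl] := exact_factorization_exists HX LX X1.
by exists l; split=> // l'; apply: exact_factorization_unique.
Qed.
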